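(* Let $J$ be a non-infinitesimal interval of ${}^\bullet\mathbb{R}$ and let $f,g:J\to{}^\bullet\mathbb{R}$ be smooth functions. Let $a,b\in J$ with $a<b$. Then $$\left(\int_a^b fg\right)^2\le\left(\int_a^b f^2\right)\cdot\left(\int_a^b g^2\right).$$
   Context: Fermat reals: let $\mathbb{R}_o[t]$ be the set of maps $x:\mathbb{R}_{\ge0}\to\mathbb{R}$, $t\mapsto x_t$, of the form $x_t=r+\sum_{i=1}^k\alpha_i t^{a_i}+o(t)$ as $t\to0^+$, with $k\in\mathbb{N}$, $r,\alpha_i\in\mathbb{R}$, $a_i\in\mathbb{R}_{\ge0}$. Write $x\sim y$ iff $x_t=y_t+o(t)$ as $t\to0^+$. The ring of Fermat reals is ${}^\bullet\mathbb{R}:=\mathbb{R}_o[t]/\sim$ with pointwise operations; $\mathbb{R}\subseteq{}^\bullet\mathbb{R}$ via constants. The standard part of $x=[x_t]$ is ${}^\circ x:=x_0$. ${}^\bullet\mathbb{R}$ is totally ordered by: $x\le y$ iff for representatives there is $z\in\mathbb{R}_o[t]$ with $z\sim0$ and $x_t\le y_t+z_t$ for all small $t\ge0$. $\overline{{}^\bullet\mathbb{R}}:={}^\bullet\mathbb{R}\cup\{\pm\infty\}$, ${}^\circ(\pm\infty):=\pm\infty$. An interval is a set $[a,b],(a,b),[a,b),(a,b]$ of points of ${}^\bullet\mathbb{R}$ with $a\le b$ in $\overline{{}^\bullet\mathbb{R}}$; non-infinitesimal if ${}^\circ a<{}^\circ b$. The Fermat topology on ${}^\bullet\mathbb{R}^n$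 has open sets ${}^\bullet V:=\{x:{}^\circ x\in V\}$, $V\subseteq\mathbb{R}^n$ open. For $\alpha\in C^\infty(W,\mathbb{R}^m)$, $W\subseteq\mathbb{R}^d$ open, ${}^\bullet\alpha([x_t]):=[\alpha(x_t)]$. A map $f:S\to{}^\bullet\mathbb{R}^m$, $S\subseteq{}^\bullet\mathbb{R}^n$, is smooth if for every $x\in S$ there exist open $V\subseteq\mathbb{R}^n$ with $x\in{}^\bullet V$, open $P\subseteq\mathbb{R}^{\mathsf p}$, $p\in{}^\bullet P$, $\alpha\in C^\infty(P\times V,\mathbb{R}^m)$ with $f(y)={}^\bullet\alpha(p,y)$ for $y\in{}^\bullet V\cap S$. For $g$ smooth on a non-infinitesimal interval $J$ and $x\in J$, $g'(x):={}^\bullet(\partial_2\alpha)(p,x)$ for any local representation of $g$ around $x$ (independent of it). Integral: for a non-infinitesimal interval $J$, smooth $f:J\to{}^\bullet\mathbb{R}$ and $u\in J$, $\int_u^{(-)}f$ is the unique smooth $I:J\to{}^\bullet\mathbb{R}$ with $I(u)=0$ and $I'(x)=f(x)$ for all $x\in J$, and $\int_u^v f:=I(v)$ for $v\in J$. *)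

(* Defs.v *)
From HB Require Import structures.
From mathcomp Require Import all_boot all_order all_algebra.
From mathcomp Require Import all_classical all_reals all_analysis.
From Stdlib Require Import ClassicalEpsilon.
Set Implicit Arguments. Unset Strict Implicit. Unset Printing Implicit Defensive.
Import Order.TTheory GRing.Theory Num.Theory.
Import numFieldNormedType.Exports.
Local Open Scope classical_set_scope.
Local Open Scope ring_scope.

Section Fermat.
Variable R : realType.

(* A "raw" curve t |-> x_t; only its values for t >= 0 are ever inspected. *)
Definition curve := R -> R.

Definition little_o (w : curve) : Prop :=
  w 0 = 0 /\ (fun t => w t / t) @ 0^'+ --> (0 : R).

Definition eqo (x y : curve) : Prop := little_o (fun t => x t - y t).

Definition in_Ro (x : curve) : Prop :=
  exists (k : nat) (r : R) (al e : 'I_k -> R),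
    (forall i, 0 <= e i) /\
    little_o (fun t => x t - (r + \sum_(i < k) al i * powR t (e i))).

(* points of the Fermat reals, given by representatives *)
Definition FR := {x : curve | in_Ro x}.
Definition rep (x : FR) : curve := proj1_sig x.

Definition st (x : FR) : R := rep x 0.

Definition leF (x y : curve) : Prop :=
  exists z : curve, in_Ro z /\ eqo z (fun _ => 0) /\
    exists d : R, 0 < d /\ forall t, 0 <= t -> t < d -> x t <= y t + z t.
Definition ltF (x y : curve) : Prop := leF x y /\ ~ eqo x y.

Inductive xFR := XFin of FR | XPinf | XNinf.
Definition xst (a : xFR) : \bar R :=
  match a with XFin x => (st x)%:E | XPinf => +oo%E | XNinf => -oo%E end.

Record fitv := FItv {
  lo : xFR; hi : xFR; lo_closed : bool; hi_closed : bool }.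

Definition in_fitv (J : fitv) (x : FR) : Prop :=
  (match lo J with
   | XFin a => if lo_closed J then leF (rep a) (rep x) else ltF (rep a) (rep x)
   | XNinf => True | XPinf => False end) /\
  (match hi J with
   | XFin b => if hi_closed J then leF (rep x) (rep b) else ltF (rep x) (rep b)
   | XPinf => True | XNinf => False end).

Definition noninf (J : fitv) : Prop :=
  (match lo J, hi J with
   | XFin a, XFin b => leF (rep a) (rep b)
   | XNinf, _ => True | _, XPinf => True | _, _ => False end) /\
  (xst (lo J) < xst (hi J))%E.

Fixpoint Cn (k n : nat) (U : set 'rV[R]_k) (F : 'rV[R]_k -> R) : Prop :=
  match n with
  | O => forall z, U z -> {for z, continuous F}
  | S m => (forall z, U z -> {for z, continuous F}) /\
      forall i : 'I_k, (forall z, U z -> derivable F z (delta_mx 0 i)) /\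
        Cn m U (fun z => 'D_(delta_mx 0 i) F z)
  end.
Definition Cinfty (k : nat) (U : set 'rV[R]_k) (F : 'rV[R]_k -> R) : Prop :=
  forall n, Cn n U F.

Definition prodPV (q : nat) (P : set 'rV[R]_q) (V : set R) : set 'rV[R]_(q + 1) :=
  [set z | P (lsubmx z) /\ V (rsubmx z ord0 ord0)].

Definition ptv (q : nat) (p : 'I_q -> FR) (y : FR) (t : R) : 'rV[R]_(q + 1) :=
  row_mx (\row_i rep (p i) t) (\row_(j < 1) rep y t).
Definition ext_fun (q : nat) (al : 'rV[R]_(q + 1) -> R) (p : 'I_q -> FR) (y : FR)
  : curve := fun t => al (ptv p y t).

Definition partial2 (q : nat) (al : 'rV[R]_(q + 1) -> R) : 'rV[R]_(q + 1) -> R :=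
  fun z => 'D_(delta_mx 0 (rshift q (ord0 : 'I_1))) al z.

Definition local_rep (S : set FR) (f : FR -> FR) (x : FR)
  (V : set R) (q : nat) (P : set 'rV[R]_q) (p : 'I_q -> FR)
  (al : 'rV[R]_(q + 1) -> R) : Prop :=
  open V /\ V (st x) /\ open P /\ P (\row_i st (p i)) /\
  Cinfty (prodPV P V) al /\
  forall y, S y -> V (st y) -> eqo (rep (f y)) (ext_fun al p y).

Definition fsmooth (S : set FR) (f : FR -> FR) : Prop :=
  forall x, S x -> exists V q P p al, @local_rep S f x V q P p al.

Definition deriv_is (S : set FR) (g : FR -> FR) (x : FR) (d : curve) : Prop :=
  exists V q P p al, @local_rep S g x V q P p al /\
    eqo d (ext_fun (partial2 al) p x).

Definition antider (J : fitv) (h : FR -> curve) (u : FR) (I : FR -> FR) : Prop :=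
  fsmooth (in_fitv J) I /\ eqo (rep (I u)) (fun _ => 0) /\
  forall x, in_fitv J x -> deriv_is (in_fitv J) I x (h x).

(* int_u^v h := I(v), with I the (unique) antiderivative (chosen by epsilon) *)
Definition fintegral (J : fitv) (h : FR -> curve) (u v : FR) : curve :=
  epsilon (inhabits (fun _ : R => 0 : R))
    (fun w => exists I, antider J h u I /\ w = rep (I v)).

End Fermat.

(* Main.v *)
(* Near a standard point c every smooth function is, up to a uniform o(t), a
   finite sum of terms t ^ e * d(s) with d an ordinary smooth function: expand
   the local representation by Taylor's formula in its parameters, which are
   Fermat reals.  The coefficients of the powers t ^ e with e <= 1 are determined
   by the values at standard points, so identities between smooth functions can
   be checked there, and integration reduces to ordinary primitives of the
   coefficients.  Gluing such local primitives along the interval gives existence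
   and uniqueness of the integral.  For each small t, the primitives of fg, f^2
   and g^2 satisfy the classical Cauchy-Schwarz inequality on a short interval,
   and that inequality is additive under concatenation of intervals. *)
From HB Require Import structures.
Require Import Defs.
From mathcomp Require Import all_boot all_order all_algebra.
From mathcomp Require Import all_classical all_reals all_analysis.
From mathcomp Require Import ring lra.
From Stdlib Require Import ClassicalEpsilon.
Set Implicit Arguments. Unset Strict Implicit. Unset Printing Implicit Defensive.
Import Order.TTheory GRing.Theory Num.Theory.
Import numFieldNormedType.Exports.
Local Open Scope classical_set_scope.
Local Open Scope ring_scope.

(** * Curves that are o(t) *)

(** Equality in the ring is equality up to o(t) at each point separately, and each point may come
    with its own local representation and its own parameters. Several obstacles follow. An o(t) at
    every fixed point says nothing along a curve [y t], hence the remainders uniform in [s]. A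
    Taylor remainder is negligible only because some power of [y t - y 0] is o(t): the
    infinitesimals of this ring are nilpotent. Points infinitely close to an end of the interval may
    lie beyond all of its standard points; they are reached because a coefficient that vanishes on
    one side of the end has all its derivatives zero at the end, so that Taylor's formula gives
    vanishing on the other side as well. The threshold e = 1 is that of o(t) itself: t ^ e with e >
    1 is zero in the ring, while distinct powers with e <= 1 are independent modulo o(t). Finally,
    the order of the Fermat reals is itself known only up to o(t), so the upper limit of integration
    is moved by o(t) until the two limits are ordered for every small t. The real inequality then
    holds exactly for each such t, and the errors stay outside it until the end. *)

Section SmallCurves.
Variable R : realType.
Implicit Types (w v : R -> R) (P Q : R -> Prop).

(* [t = 0] is included in order to capture the clause [w 0 = 0] of [little_o]. *)
Definition near0 P := exists2 tau : R, 0 < tau & forall t, 0 <= t < tau -> P t.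

Lemma near0T P : (forall t, 0 <= t -> P t) -> near0 P.
Proof. by move=> H; exists 1 => // t /andP[t0 _]; exact: H. Qed.

Lemma near0_lt (d : R) : 0 < d -> near0 (fun t => 0 <= t < d).
Proof. by move=> d0; exists d. Qed.

Lemma near0S2 P Q (T : R -> Prop) :
  (forall t, P t -> Q t -> T t) -> near0 P -> near0 Q -> near0 T.
Proof.
move=> H [a a0 Ha] [b b0 Hb]; exists (Num.min a b).
  by rewrite lt_min a0.
move=> t /andP[t0]; rewrite lt_min => /andP[ta tb].
by apply: H; [apply: Ha|apply: Hb]; rewrite t0.
Qed.

Lemma near0S P Q : (forall t, P t -> Q t) -> near0 P -> near0 Q.
Proof. by move=> H e; apply: (near0S2 _ e e) => t p _; exact: H. Qed.

Lemma near0S3 P Q (T U : R -> Prop) :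
  (forall t, P t -> Q t -> T t -> U t) -> near0 P -> near0 Q -> near0 T -> near0 U.
Proof.
move=> H eP eQ; apply: near0S2 (fun t (pq : P t /\ Q t) => H t pq.1 pq.2) _.
by apply: near0S2 eP eQ.
Qed.

Definition is_o w := forall e : R, 0 < e -> near0 (fun t => `|w t| <= e * t).
Definition bounded_curve w := exists M : R, near0 (fun t => `|w t| <= M).

Lemma is_o0 : is_o (fun=> 0).
Proof. by move=> e e0; apply: near0T => t t0; rewrite normr0 mulr_ge0// ltW. Qed.

Lemma is_o_le w v : near0 (fun t => `|w t| <= `|v t|) -> is_o v -> is_o w.
Proof. by move=> H o e /o; apply: near0S2 H => t /le_trans; apply. Qed.

Lemma is_o_ext w v : (forall t, 0 <= t -> w t = v t) -> is_o v -> is_o w.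
Proof. by move=> H; apply: is_o_le; apply: near0T => t /H ->. Qed.

Lemma is_oD w v : is_o w -> is_o v -> is_o (fun t => w t + v t).
Proof.
move=> ow ov e e0; have e2 : 0 < e / 2 by lra.
apply: near0S2 (ow _ e2) (ov _ e2) => t h1 h2.
by apply: le_trans (ler_normD _ _) _; lra.
Qed.

Lemma is_oN w : is_o w -> is_o (fun t => - w t).
Proof. by apply: is_o_le; apply: near0T => t _; rewrite normrN. Qed.

Lemma is_oB w v : is_o w -> is_o v -> is_o (fun t => w t - v t).
Proof. by move=> ow /is_oN; exact: is_oD. Qed.

Lemma is_oM w v : bounded_curve w -> is_o v -> is_o (fun t => w t * v t).
Proof.
move=> [M HM] ov e e0; set N := `|M| + 1.
have N0 : 0 < N by rewrite /N; have := normr_ge0 M; lra.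
apply: near0S2 HM (ov _ (divr_gt0 e0 N0)) => t h1 h2.
rewrite normrM; apply: (@le_trans _ _ (N * (e / N * t))).
  apply: ler_pM => //; apply: (le_trans h1).
  by rewrite /N; have := ler_norm M; lra.
by rewrite mulrA mulrCA divff ?gt_eqF// mulr1.
Qed.

Lemma is_o_bounded w : is_o w -> bounded_curve w.
Proof.
move=> /(_ 1 ltr01) o; exists 1; apply: near0S2 o (near0_lt ltr01) => t h /andP[_ t1].
lra.
Qed.

Lemma bounded_cst (c : R) : bounded_curve (fun=> c).
Proof. by exists `|c|; apply: near0T. Qed.

Lemma bounded_ext w v : (forall t, 0 <= t -> w t = v t) ->
  bounded_curve v -> bounded_curve w.
Proof.
by move=> H [M e]; exists M; apply: near0S2 e (near0_lt ltr01) => t h /andP[t0 _]; rewrite H.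
Qed.

Lemma boundedD w v : bounded_curve w -> bounded_curve v ->
  bounded_curve (fun t => w t + v t).
Proof.
move=> [M h] [N k]; exists (M + N); apply: near0S2 h k => t h k.
by apply: le_trans (ler_normD _ _) _; exact: lerD.
Qed.

Lemma boundedM w v : bounded_curve w -> bounded_curve v ->
  bounded_curve (fun t => w t * v t).
Proof.
move=> [M h] [N k]; exists (M * N); apply: near0S2 h k => t h k.
by rewrite normrM; apply: ler_pM.
Qed.

(** At [t = 0] the bound reads [|w 0| <= 0], which is the clause on the value at 0; for [t > 0] it
    is the limit statement multiplied by [t]. *)
Lemma little_oP w : little_o w <-> is_o w.
Proof.
split.
- move=> [w0 /cvgrPdist_le H] e e0.
  have /= := H _ e0; move=> /nbhs_right0P; case=> d /= d0 Hd.
  exists d => // t /andP[]; rewrite le_eqVlt => /predU1P[<- _|t0 td].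
    by rewrite w0 normr0 mulr0.
  have := Hd t; rewrite /= sub0r normrN gtr0_norm// => /(_ td t0).
  rewrite !add0r normrN normrM normfV (gtr0_norm t0).
  by rewrite ler_pdivrMr.
- move=> H; split.
    have [d d0 /(_ 0)] := H _ ltr01; rewrite lexx d0 mulr0 normr_le0 => h.
    by apply/eqP/h.
  apply/cvgrPdist_le => e e0; apply/nbhs_right0P.
  have [d d0 Hd] := H _ e0; exists d => //= t.
  rewrite /= sub0r normrN => td t0; move: td; rewrite gtr0_norm// => td.
  rewrite !add0r normrN normrM normfV (gtr0_norm t0) ler_pdivrMr//.
  by apply: Hd; rewrite ltW.
Qed.

Lemma eqoP (x y : curve R) : eqo x y <-> is_o (fun t => x t - y t).
Proof. exact: little_oP. Qed.

Lemma powR_small (e : R) : 0 < e -> forall r : R, 0 < r ->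
  near0 (fun t => t `^ e <= r).
Proof.
move=> e0 r r0; have /cvgrPdist_le/(_ _ r0) := @powR_cvg0 R e e0.
move=> /nbhs_right0P[d /= d0 Hd]; exists d => // t /andP[].
rewrite le_eqVlt => /predU1P[<- _|t0 td].
  by rewrite powR0 ?gt_eqF// ltW.
have := Hd t; rewrite /= sub0r normrN gtr0_norm// => /(_ td t0).
by rewrite !add0r normrN ger0_norm ?powR_ge0.
Qed.

Lemma powR_is_o (e : R) : 1 < e -> is_o (fun t => t `^ e).
Proof.
move=> e1 r r0; have e0 : 0 < e - 1 by lra.
apply: near0S2 (powR_small e0 r0) (near0_lt ltr01) => t h /andP[t0 _].
rewrite ger0_norm ?powR_ge0// -mulr_powRB1 ?(lt_trans _ e1)//.
by rewrite mulrC ler_wpM2r.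
Qed.

Lemma powR_bounded (e : R) : 0 <= e -> bounded_curve (fun t => t `^ e).
Proof.
move=> e0; exists 1; apply: near0S (near0_lt ltr01) => t /andP[t0 t1].
rewrite ger0_norm ?powR_ge0//.
by apply: le_trans (ge0_ler_powR e0 _ _ (ltW t1)) _; rewrite ?nnegrE// powR1.
Qed.

(** The case [t = 0] rests on [0 ^ 0 = 1]: both sides are 1 if both exponents vanish, and 0
    otherwise. *)
Lemma powRD_ge0 (t a b : R) : 0 <= a -> 0 <= b -> t `^ (a + b) = t `^ a * t `^ b.
Proof.
move=> a0 b0; have [->|tn] := eqVneq t 0; last by rewrite powRD// tn implybT.
have [->|an] := eqVneq a 0; first by rewrite powRr0 add0r mul1r.
have {an}a0 : 0 < a by rewrite lt0r an.
by rewrite (@powR0 _ a) ?mul0r ?powR0// gt_eqF// ltr_wpDr.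
Qed.

(* The quantitative form of infinitesimality that Taylor expansions use. *)
Definition power_small w := exists N0, forall N, (N0 <= N)%N -> is_o (fun t => w t ^+ N).

Lemma power_small_le w v (C : R) : near0 (fun t => `|w t| <= C * `|v t|) ->
  power_small v -> power_small w.
Proof.
move=> H [N0 HN]; exists N0 => N /HN o.
have := is_oM (bounded_cst (C ^+ N)) o; apply: is_o_le.
apply: near0S H => t h; rewrite normrX normrM normrX.
apply: (@le_trans _ _ ((C * `|v t|) ^+ N)); first by
  apply: lerXn2r => //; rewrite nnegrE//; exact: le_trans h.
by rewrite exprMn normrX ler_wpM2r ?exprn_ge0// -normrX ler_norm.
Qed.

Lemma is_o_power_small w : is_o w -> power_small w.
Proof.
move=> o; exists 1%N => -[//|N] _; elim: N => [|N IH].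
  by apply: is_o_ext o => t _; rewrite expr1.
by apply: is_o_ext (is_oM (is_o_bounded o) IH) => t _; rewrite exprS.
Qed.

(** A sum is at most twice the larger of its two terms; the constant [2 ^ N] is harmless for
    o(t). *)
Lemma exprD_norm_le (x y : R) N : `|x + y| ^+ N <= 2 ^+ N * (`|x| ^+ N + `|y| ^+ N).
Proof.
wlog h : x y / `|y| <= `|x|.
  case: (leP `|y| `|x|) => [le H|/ltW le H]; first exact: H.
  by rewrite addrC [`|x| ^+ _ + _]addrC; exact: H.
apply: (@le_trans _ _ ((2 * `|x|) ^+ N)).
  apply: lerXn2r; rewrite ?nnegrE// ?mulr_ge0//.
  by apply: le_trans (ler_normD _ _) _; lra.
by rewrite exprMn ler_wpM2l ?exprn_ge0// lerDl exprn_ge0.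
Qed.

Lemma power_smallD w v : power_small w -> power_small v -> power_small (fun t => w t + v t).
Proof.
move=> [N0 HN] [M0 HM]; exists (maxn N0 M0) => N; rewrite geq_max => /andP[n m].
apply: (@is_o_le _ (fun t => 2 ^+ N * (`|w t ^+ N| + `|v t ^+ N|))).
  apply: near0T => t _; rewrite normrX [leRHS]ger0_norm; last first.
    by rewrite mulr_ge0 ?addr_ge0 ?exprn_ge0.
  by rewrite !normrX; exact: exprD_norm_le.
apply: is_oM; first exact: bounded_cst.
by apply: is_oD; [apply: is_o_le (HN _ n)|apply: is_o_le (HM _ m)];
  apply: near0T => t _; rewrite normr_id.
Qed.

Lemma power_small_powR (e : R) : 0 < e -> power_small (fun t => t `^ e).
Proof.
(* This gives [N > 2 / e], so the exponent [e * N] exceeds 1. *)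
move=> e0; exists (Num.truncn (2 / e)).+1 => N HN.
apply: (@is_o_ext _ (fun t => t `^ (e * N%:R))).
  by move=> t t0; rewrite powRrM powR_mulrn// powR_ge0.
apply: powR_is_o; rewrite -ltr_pdivrMl// mulr1.
apply: (@lt_le_trans _ _ (Num.truncn (2 / e)).+1%:R); last by rewrite ler_nat.
apply: le_lt_trans (truncnS_gt _).
by rewrite -[leLHS]mul1r ler_wpM2r// ?invr_ge0 ?ltW//; lra.
Qed.

Lemma power_small_lt w : power_small w -> forall d : R, 0 < d -> near0 (fun t => `|w t| < d).
Proof.
move=> [N0 H] d d0.
have N1 : (N0 <= maxn N0 1)%N by rewrite leq_maxl.
have M0 : (0 < maxn N0 1)%N by rewrite leq_max orbT.
move: (maxn N0 1) N1 M0 => N /H o N0'.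
have dN : 0 < d ^+ N by rewrite exprn_gt0.
apply: near0S2 (o _ dN) (near0_lt ltr01) => t h /andP[t0 t1].
rewrite ltNge; apply/negP => h2.
have : d ^+ N <= `|w t ^+ N| by rewrite normrX; apply: lerXn2r; rewrite ?nnegrE// ltW.
have := ltr_pM2l dN t 1; rewrite t1 mulr1; lra.
Qed.

Lemma power_small0 w : power_small w -> w 0 = 0.
Proof.
move=> H; apply/eqP; rewrite -normr_eq0 eq_le normr_ge0 andbT.
apply/ler_addgt0Pl => e e0; rewrite addr0; apply: ltW.
by have [d d0] := power_small_lt H e0; apply; rewrite lexx.
Qed.

End SmallCurves.

(** * Little-oh polynomials *)

Section Ro.
Variable R : realType.
Implicit Types (w v x y : R -> R).

(** Lists of pairs (exponent, coefficient), with the constant as a term of exponent 0, turn sums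
    into concatenation and products into [allpairs]. *)
Lemma in_RoP x : in_Ro x <-> exists2 l : seq (R * R),
  all (fun p => 0 <= p.1) l & is_o (fun t => x t - \sum_(p <- l) p.2 * t `^ p.1).
Proof.
split.
- move=> [k [r [al [e [e0 /little_oP o]]]]].
  exists ((0, r) :: [seq (e i, al i) | i <- index_enum 'I_k]).
    by rewrite /= lexx all_map; apply/allP => i _ /=.
  apply: is_o_ext o => t _; congr (_ - _).
  by rewrite big_cons /= powRr0 mulr1 big_map.
(* Any constant is already in the list as a term of exponent 0, so [r] is 0. *)
- move=> [l l0 o]; exists (size l), 0.
  exists (fun i => (nth (0, 0) l i).2), (fun i => (nth (0, 0) l i).1); split.
    by move=> i; apply: (all_nthP _ l0).
  apply/little_oP; apply: is_o_ext o => t _; congr (_ - _).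
  by rewrite add0r (big_nth (0, 0)) big_mkord.
Qed.

Lemma in_Ro_is_o x y : is_o (fun t => x t - y t) -> in_Ro y -> in_Ro x.
Proof.
move=> o /in_RoP[l l0 o']; apply/in_RoP; exists l => //.
by apply: is_o_ext (is_oD o o') => t _; rewrite /=; ring.
Qed.

Lemma in_Ro_is_o0 x : is_o x -> in_Ro x.
Proof.
move=> o; apply/in_RoP; exists [::] => //.
by apply: is_o_ext o => t _; rewrite big_nil subr0.
Qed.

Lemma in_Ro_cst (c : R) : in_Ro (fun=> c).
Proof.
apply/in_RoP; exists [:: (0, c)]; rewrite /= ?lexx//.
by apply: is_o_ext (@is_o0 R) => t _; rewrite big_seq1 /= powRr0 mulr1 subrr.
Qed.

Lemma in_Ro_powR (e : R) : 0 <= e -> in_Ro (fun t => t `^ e).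
Proof.
move=> e0; apply/in_RoP; exists [:: (e, 1)]; rewrite /= ?e0//.
by apply: is_o_ext (@is_o0 R) => t _; rewrite big_seq1 /= mul1r subrr.
Qed.

Lemma in_RoD x y : in_Ro x -> in_Ro y -> in_Ro (fun t => x t + y t).
Proof.
move=> /in_RoP[l l0 o] /in_RoP[l' l0' o']; apply/in_RoP; exists (l ++ l').
  by rewrite all_cat l0.
by apply: is_o_ext (is_oD o o') => t _; rewrite big_cat /=; ring.
Qed.

Lemma powR_sum_bounded (l : seq (R * R)) : all (fun p => 0 <= p.1) l ->
  bounded_curve (fun t => \sum_(p <- l) p.2 * t `^ p.1).
Proof.
elim: l => [_|p l IH /= /andP[p0 l0]].
  by apply: bounded_ext (bounded_cst 0) => t _; rewrite big_nil.
apply: bounded_ext (boundedD (boundedM (bounded_cst p.2) (powR_bounded p0)) (IH l0)).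
by move=> t _; rewrite big_cons.
Qed.

Lemma in_Ro_bounded x : in_Ro x -> bounded_curve x.
Proof.
move=> /in_RoP[l l0 o].
apply: bounded_ext (boundedD (is_o_bounded o) (powR_sum_bounded l0)) => t _.
by rewrite subrK.
Qed.

Lemma in_RoM x y : in_Ro x -> in_Ro y -> in_Ro (fun t => x t * y t).
Proof.
move=> rx ry; move: (rx) (ry) => /in_RoP[l l0 o] /in_RoP[l' l0' o'].
apply/in_RoP; exists [seq (p.1 + q.1, p.2 * q.2) | p <- l, q <- l'].
  apply/allP => _ /allpairsP[[p q] /= [pl ql ->]] /=.
  by apply: addr_ge0; [exact: (allP l0)|exact: (allP l0')].
have := is_oD (is_oM (in_Ro_bounded ry) o) (is_oM (powR_sum_bounded l0) o').
apply: is_o_ext => t _; rewrite big_allpairs_dep.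
rewrite [X in x t * y t - X](_ : _ = (\sum_(p <- l) p.2 * t `^ p.1) *
   (\sum_(p <- l') p.2 * t `^ p.1)); first by ring.
rewrite mulr_suml; apply: eq_big_seq => p pl.
rewrite mulr_sumr; apply: eq_big_seq => q ql /=.
by rewrite powRD_ge0; [ring|exact: (allP l0)|exact: (allP l0')].
Qed.

Lemma in_RoZ (c : R) x : in_Ro x -> in_Ro (fun t => c * x t).
Proof. exact: in_RoM (in_Ro_cst c). Qed.

Lemma in_RoB x y : in_Ro x -> in_Ro y -> in_Ro (fun t => x t - y t).
Proof.
move=> rx ry; have := in_RoD rx (in_RoZ (-1) ry).
by congr in_Ro; apply/funext => t; rewrite mulN1r.
Qed.

Lemma in_RoX x n : in_Ro x -> in_Ro (fun t => x t ^+ n).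
Proof.
move=> rx; elim: n => [|n IH].
  by have := in_Ro_cst 1; congr in_Ro; apply/funext => t; rewrite expr0.
by have := in_RoM rx IH; congr in_Ro; apply/funext => t; rewrite exprS.
Qed.

Lemma in_Ro_sum (I : Type) (r : seq I) (w : I -> R -> R) :
  (forall i, in_Ro (w i)) -> in_Ro (fun t => \sum_(i <- r) w i t).
Proof.
move=> H; elim: r => [|i r IH].
  by have := in_Ro_cst 0; congr in_Ro; apply/funext => t; rewrite big_nil.
by have := in_RoD (H i) IH; congr in_Ro; apply/funext => t; rewrite big_cons.
Qed.

(** After subtraction of the value at 0 the terms of exponent 0 cancel, and a positive power of [t]
    has a multiple exponent above 1. *)
Lemma in_Ro_power_small x : in_Ro x -> power_small (fun t => x t - x 0).
Proof.
move=> /in_RoP[l l0 o].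
have E : x 0 - \sum_(p <- l) p.2 * 0 `^ p.1 = 0 by exact: power_small0 (is_o_power_small o).
have : power_small (fun t => \sum_(p <- l) p.2 * (t `^ p.1 - 0 `^ p.1)).
  elim: l l0 {o E} => [_|p l IH /= /andP[p0 /IH l0]].
    apply: (@power_small_le _ _ _ 0) (is_o_power_small (@is_o0 R)).
    by apply: near0T => t _; rewrite big_nil normr0 mulr0.
  have : power_small (fun t => p.2 * (t `^ p.1 - 0 `^ p.1) +
      \sum_(q <- l) q.2 * (t `^ q.1 - 0 `^ q.1)).
    apply: power_smallD l0 => //.
    move: p0; rewrite le_eqVlt => /predU1P[<-|p0].
      apply: (@power_small_le _ _ _ 0) (is_o_power_small (@is_o0 R)).
      by apply: near0T => t _; rewrite !powRr0 subrr mulr0 normr0 mulr0.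
    apply: (@power_small_le _ _ _ `|p.2|) (power_small_powR p0); apply: near0T => t _.
    by rewrite powR0 ?gt_eqF// subr0 normrM.
  by congr power_small; apply/funext => t; rewrite big_cons.
move=> /(power_smallD (is_o_power_small o)); congr power_small; apply/funext => t.
rewrite [X in _ + X = _](_ : _ = \sum_(p <- l) p.2 * t `^ p.1 -
    \sum_(p <- l) p.2 * 0 `^ p.1); last first.
  by rewrite -sumrB; apply: eq_bigr => p _; rewrite mulrBr.
by move/eqP: E; rewrite subr_eq0 => /eqP <-; ring.
Qed.

End Ro.

(** * Mean value and Taylor estimates *)

Section Calculus.
Variable R : realType.
Implicit Types (f df : R -> R) (D : nat -> R -> R).

Lemma mvt f df (a b : R) : a <= b ->
  (forall z, a <= z <= b -> is_derive z 1 f (df z)) ->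
  exists2 z, a <= z <= b & f b - f a = df z * (b - a).
Proof.
move=> ab H; have [||c] := @MVT_segment R f df a b ab.
- by move=> z; rewrite in_itv/= => /andP[az zb]; apply: H; rewrite !ltW.
- apply: derivable_within_continuous => z; rewrite in_itv/= => /H.
  by move=> h; apply: ex_derive.
- by rewrite in_itv/= => czb E; exists c.
Qed.

Lemma mvt_le f df (c x M : R) :
  (forall z, `|z - c| <= `|x - c| -> is_derive z 1 f (df z)) ->
  (forall z, `|z - c| <= `|x - c| -> `|df z| <= M) ->
  `|f x - f c| <= M * `|x - c|.
Proof.
move=> H HM; case: (leP c x) => cx.
- have [|z zi ->] := @mvt f df c x cx.
    move=> z /andP[z1 z2]; apply: H; rewrite !ger0_norm ?subr_ge0//.
    by rewrite lerB.
  rewrite normrM ler_wpM2r//; apply: HM.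
  by case/andP: zi => z1 z2; rewrite !ger0_norm ?subr_ge0// lerB.
- have [|z zi] := @mvt f df x c (ltW cx).
    move=> z /andP[z1 z2]; apply: H; rewrite !ler0_norm; lra.
  rewrite -(normrN (f x - f c)) opprB => ->; rewrite normrM (distrC c) ler_wpM2r//.
  apply: HM; case/andP: zi => z1 z2; rewrite !ler0_norm; lra.
Qed.

(** Induction on [N]: the remainder [f] vanishes at [c], and its derivative [df] is the remainder of
    the shifted sequence, one order lower. The crude constant without [1 / N!] suffices, and the
    symmetric ball around [c] covers both positions of [x]. *)
Lemma taylor_le D (N : nat) (c x M : R) :
  (forall n z, (n < N)%N -> `|z - c| <= `|x - c| -> is_derive z 1 (D n) (D n.+1 z)) ->
  (forall z, `|z - c| <= `|x - c| -> `|D N z| <= M) ->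
  `|D 0%N x - \sum_(n < N) D n c * (x - c) ^+ n / n`!%:R| <= M * `|x - c| ^+ N.
Proof.
elim: N D x => [|N IH] D x HD HM.
  by rewrite big_ord0 subr0 expr0 mulr1; exact: HM.
pose f y := D 0%N y - \sum_(n < N.+1) D n c * (y - c) ^+ n / n`!%:R.
pose df y := D 1%N y - \sum_(n < N) D n.+1 c * (y - c) ^+ n / n`!%:R.
have fc : f c = 0.
  rewrite /f big_ord_recl /= expr0 fact0 invr1 !mulr1 big1 ?addr0 ?subrr// => i _.
  by rewrite exprS mul0r mulr0 mul0r.
have -> : D 0%N x - \sum_(n < N.+1) D n c * (x - c) ^+ n / n`!%:R = f x - f c.
  by rewrite fc subr0.
rewrite exprSr mulrA; apply: (@mvt_le f df) => z zx.
  rewrite /f /df; apply: is_deriveB; first exact: HD.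
  under eq_fun do rewrite big_ord_recl.
  rewrite -[X in is_derive _ _ _ X]add0r; apply: is_deriveD.
    under eq_fun do rewrite expr0.
    exact: is_derive_cst.
  rewrite [X in is_derive _ _ X](_ : _ =
      \sum_(n < N) (fun y : R => D n.+1 c / n.+1`!%:R * (y - c) ^+ n.+1)); last first.
    by apply/funext => y; rewrite fct_sumE; apply: eq_bigr => n _; rewrite /= mulrAC.
  apply: is_derive_sum => n.
  have -> : D n.+1 c * (z - c) ^+ n / n`!%:R =
      D n.+1 c / n.+1`!%:R * (n.+1%:R * (z - c) ^+ n * 1).
    rewrite factS natrM invfM; field.
    by rewrite addrC natr1 !pnatr_eq0 -lt0n fact_gt0.
  apply: is_deriveZ; rewrite [X in is_derive _ _ X](_ : _ = (fun y : R => y - c) ^+ n.+1); last first.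
    by apply/funext => y; rewrite fctE.
  apply: is_derive_eq (@is_deriveX R R (fun y : R => y - c) n.+1 z 1 1 _) _ => //.
  by rewrite -[X in is_derive _ _ _ X]subr0; apply: is_deriveB.
apply: le_trans (IH (fun n => D n.+1) z _ _) _.
- by move=> n y nN yz; apply: HD => //; exact: le_trans zx.
- by move=> y yz; apply: HM; exact: le_trans zx.
- rewrite ler_wpM2l ?lerXn2r ?nnegrE//.
  (* [M] is nonnegative because it bounds an absolute value at [c]. *)
  by apply: le_trans (HM c _); rewrite // subrr normr0.
Qed.

End Calculus.

(** * Smooth functions of one real variable *)

Section Tower.
Variable R : realType.
Implicit Types (U : set R) (D : nat -> R -> R).

Definition nbh (c d : R) : set R := [set s | `|s - c| < d].

(** A smooth function is carried together with all its derivatives: differentiation is then a shift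
    of the sequence, and taking a primitive adds a new term in front. *)
Definition tower U D := forall n s, U s -> is_derive s 1 (D n) (D n.+1 s).

Lemma nbh_center (c d : R) : 0 < d -> nbh c d c.
Proof. by rewrite /nbh /= subrr normr0. Qed.

Lemma nbh_le (c d d' : R) : d <= d' -> nbh c d `<=` nbh c d'.
Proof. by move=> dd s /= /lt_le_trans; apply. Qed.

Lemma nbh_move (c d c' : R) : nbh c d c' -> exists2 d', 0 < d' & nbh c' d' `<=` nbh c d.
Proof.
rewrite /nbh /= => h; exists (d - `|c' - c|); first by rewrite subr_gt0.
move=> s /= h'; have := ler_normD (s - c') (c' - c).
rewrite [_ + (c' - c)](_ : _ = s - c); [lra|ring].
Qed.

Lemma tower_sub U U' D : U' `<=` U -> tower U D -> tower U' D.
Proof. by move=> UU h n s /UU; exact: h. Qed.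

Lemma tower_shift U D : tower U D -> tower U (fun n => D n.+1).
Proof. by move=> h n; exact: h. Qed.

Lemma tower_cst U (c : R) : tower U (fun n _ => if n is 0%N then c else 0).
Proof. by move=> [|n] s _; exact: is_derive_cst. Qed.

Lemma towerD U D D' : tower U D -> tower U D' -> tower U (fun n s => D n s + D' n s).
Proof. by move=> h h' n s Us; apply: is_deriveD; [exact: h|exact: h']. Qed.

Lemma towerZ U (c : R) D : tower U D -> tower U (fun n s => c * D n s).
Proof. by move=> h n s Us; apply: is_deriveZ; exact: h. Qed.

(** The n-th derivative of a product as the [2 ^ n] uncollected terms of the Leibniz rule, which
    keeps binomial coefficients out of the induction. *)
Fixpoint leibniz (n : nat) D D' (s : R) : R :=
  if n is m.+1 then leibniz m (fun k => D k.+1) D' s + leibniz m D (fun k => D' k.+1) s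
  else D 0%N s * D' 0%N s.

Lemma tower_leibniz U D D' : tower U D -> tower U D' ->
  tower U (fun n => leibniz n D D').
Proof.
move=> h h' n s Us; elim: n D D' h h' => [|n IH] D D' h h'.
  apply: is_derive_eq (is_deriveM (h 0%N s Us) (h' 0%N s Us)) _.
  by rewrite /GRing.scale/=; ring.
by apply: is_deriveD; apply: IH => // m; [apply: h|apply: h'].
Qed.

Lemma is_derive_continuous (f : R -> R) (s df : R) : is_derive s 1 f df ->
  {for s, continuous f}.
Proof. by move=> h; apply/differentiable_continuous/derivable1_diffP; case: h. Qed.

Lemma is_derive_bounded (f : R -> R) (s df : R) : is_derive s 1 f df ->
  exists2 d, 0 < d & exists M : R, forall x, nbh s d x -> `|f x| <= M.
Proof.
move=> /is_derive_continuous /cvgrPdist_le /(_ _ ltr01)[d /= d0 H].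
exists d => //; exists (1 + `|f s|) => x h; have := H x; rewrite /= distrC => /(_ h) k.
have := ler_normD (f x - f s) (f s); rewrite subrK distrC; lra.
Qed.

Lemma tower_bounded U (c d : R) D n : 0 < d -> nbh c d `<=` U -> tower U D ->
  exists2 d', 0 < d' & exists M, forall s, nbh c d' s -> `|D n s| <= M.
Proof.
by move=> d0 dU h; apply: is_derive_bounded (h n c _); apply: dU; exact: nbh_center.
Qed.

(** The integral starts at [c - d / 2], and the radius is halved so that the closed segment of
    integration lies where [f] is continuous. *)
Lemma primitive (c d : R) (f : R -> R) : 0 < d ->
  (forall s, nbh c d s -> {for s, continuous f}) ->
  exists P : R -> R, forall s, nbh c (d / 2) s -> is_derive s 1 P (f s).
Proof.
move=> d0 fc; pose a := c - d / 2; pose u := c + d / 2.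
exists (fun x => \int[lebesgue_measure]_(t in [set` `[a, x]]) f t)%R => s.
rewrite /nbh /= ltr_norml => /andP[s1 s2].
have [] := @continuous_FTC1_closed R f a s u.
- by rewrite /u; lra.
- apply: continuous_compact_integrable; first exact: segment_compact.
  apply: continuous_in_subspaceT => x; rewrite inE /= in_itv /= => /andP[x1 x2].
  by apply: fc; rewrite /nbh /= ltr_norml; move: x1 x2; rewrite /a /u => ? ?; lra.
- by rewrite /a; lra.
- by apply: fc; rewrite /nbh /= ltr_norml; lra.
by move=> dP PE; split; [exact: dP|rewrite -derive1E; exact: PE].
Qed.

Lemma tower_primitive (c d : R) D : 0 < d -> tower (nbh c d) D ->
  exists2 D', tower (nbh c (d / 2)) D' & forall n, D' n.+1 = D n.
Proof.
move=> d0 h; have [s /(h 0%N s) /is_derive_continuous//|P HP] := @primitive c d (D 0%N) d0.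
exists (fun n => if n is m.+1 then D m else P) => // -[|n] s hs; first exact: HP.
by apply: h; apply: nbh_le hs; lra.
Qed.

(** Taylor's formula at [y 0], of an order [N] for which [(y t - y 0) ^+ N] is o(t): what remains is
    a polynomial in a little-oh polynomial. *)
Lemma tower_Ro U (d : R) D (y : R -> R) n : 0 < d -> in_Ro y -> nbh (y 0) d `<=` U ->
  tower U D -> in_Ro (fun t => D n (y t)).
Proof.
move=> d0 ry dU h; have [N /(_ N (leqnn N)) oN] := in_Ro_power_small ry.
have [d' d'0 [M HM]] := tower_bounded (n + N) d0 dU h.
pose P t := \sum_(k < N) D (n + k)%N (y 0) / k`!%:R * (y t - y 0) ^+ k.
apply: (@in_Ro_is_o _ _ P); last first.
  apply: in_Ro_sum => k; apply: in_RoZ; apply: in_RoX.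
  by apply: in_RoB => //; exact: in_Ro_cst.
have := is_oM (bounded_cst M) oN; apply: is_o_le.
apply: near0S2 (power_small_lt (in_Ro_power_small ry) d0) (power_small_lt (in_Ro_power_small ry) d'0).
move=> t yd yd'; rewrite normrM normrX.
apply: (@le_trans _ _ (M * `|y t - y 0| ^+ N)); last by rewrite ler_wpM2r ?ler_norm ?exprn_ge0.
apply: le_trans (@taylor_le _ (fun k => D (n + k)%N) N (y 0) (y t) M _ _).
- rewrite le_eqVlt; apply/orP; left; apply/eqP; congr `|_|.
  rewrite addn0; congr (_ - _); apply: eq_bigr => k _; ring.
- move=> k z _ zy; rewrite addnS; apply: h; apply: dU; exact: le_lt_trans yd.
- move=> z zy; apply: HM; exact: le_lt_trans yd'.
Qed.

End Tower.

(** * Finite sums of powers of t with smooth coefficients *)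

Section NormalForms.
Variable R : realType.
Implicit Types (U : set R) (D : nat -> R -> R) (F G : nat -> R -> R -> R).

(* [F n t s] is the n-th [s]-derivative of a finite sum of terms [t `^ e * d s]. *)
Inductive NF U : (nat -> R -> R -> R) -> Prop :=
| NF_nil : NF U (fun _ _ _ => 0)
| NF_cons e D F : 0 <= e -> tower U D -> NF U F ->
    NF U (fun n t s => t `^ e * D n s + F n t s).

Lemma NF_ext U F G : NF U F -> (forall n t s, G n t s = F n t s) -> NF U G.
Proof.
by move=> h E; rewrite (_ : G = F)//; apply/funext => n; apply/funext => t; apply/funext => s.
Qed.

Lemma NF_sub U U' F : U' `<=` U -> NF U F -> NF U' F.
Proof.
move=> UU; elim=> [|e D {}F e0 hD _ IH]; first exact: NF_nil.
by apply: NF_cons => //; exact: tower_sub UU hD.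
Qed.

Lemma NF_single U e D : 0 <= e -> tower U D -> NF U (fun n t s => t `^ e * D n s).
Proof.
move=> e0 hD; apply: NF_ext (NF_cons e0 hD (NF_nil U)) _ => n t s.
by rewrite addr0.
Qed.

Lemma NFD U F G : NF U F -> NF U G -> NF U (fun n t s => F n t s + G n t s).
Proof.
move=> + hG; elim=> [|e D {}F e0 hD _ IH].
  by apply: NF_ext hG _ => n t s; rewrite add0r.
by apply: NF_ext (NF_cons e0 hD IH) _ => n t s; rewrite addrA.
Qed.

(** Only level 0 is specified: on [U] the higher levels are its derivatives by [NF_derive]. *)
Lemma NF_mul_term U e D F : 0 <= e -> tower U D -> NF U F ->
  exists2 G, NF U G & forall t s, G 0%N t s = t `^ e * D 0%N s * F 0%N t s.
Proof.
move=> e0 hD; elim=> [|a E {}F a0 hE _ [G hG GE]].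
  by exists (fun _ _ _ => 0) => [|t s]; [exact: NF_nil|rewrite mulr0].
exists (fun n t s => t `^ (e + a) * leibniz n D E s + G n t s).
  by apply: NF_cons => //; [exact: addr_ge0|exact: tower_leibniz].
by move=> t s /=; rewrite GE powRD_ge0//; ring.
Qed.

Lemma NFM U F G : NF U F -> NF U G ->
  exists2 H, NF U H & forall t s, H 0%N t s = F 0%N t s * G 0%N t s.
Proof.
move=> + hG; elim=> [|e D {}F e0 hD _ [H hH HE]].
  by exists (fun _ _ _ => 0) => [|t s]; [exact: NF_nil|rewrite mul0r].
have [K hK KE] := NF_mul_term e0 hD hG.
exists (fun n t s => K n t s + H n t s); first exact: NFD.
by move=> t s; rewrite KE HE; ring.
Qed.

Lemma NFZ U (c : R) F : NF U F -> NF U (fun n t s => c * F n t s).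
Proof.
elim=> [|e D {}F e0 hD _ IH].
  by apply: NF_ext (NF_nil U) _ => n t s; rewrite mulr0.
by apply: NF_ext (NF_cons e0 (towerZ c hD) IH) _ => n t s; ring.
Qed.

Lemma NFB U F G : NF U F -> NF U G -> NF U (fun n t s => F n t s - G n t s).
Proof.
by move=> hF /(NFZ (-1)) /(NFD hF) h; apply: NF_ext h _ => n t s; ring.
Qed.

Lemma NF_shift U F : NF U F -> NF U (fun n => F n.+1).
Proof.
elim=> [|e D {}F e0 hD _ IH]; first exact: NF_nil.
exact: NF_cons e0 (tower_shift hD) IH.
Qed.

(** The subtracted term does not depend on [s], so only level 0 changes. Statements about increments
    from [c] thus become statements about vanishing. *)
Definition freeze (c : R) F n t s : R := F n t s - (if n is 0%N then F 0%N t c else 0).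

Lemma NF_freeze U c F : NF U F -> NF U (freeze c F).
Proof.
move=> hF; suff h : NF U (fun n t s => if n is 0%N then F 0%N t c else 0) by exact: NFB.
elim: hF => [|e D {}F e0 hD _ IH].
  by apply: NF_ext (NF_nil U) _ => -[].
apply: NF_ext (NF_cons e0 (tower_cst (D 0%N c)) IH) _ => -[|n] t s //=.
by rewrite mulr0 addr0.
Qed.

Lemma NF_derive U F : NF U F ->
  forall n t s, U s -> is_derive s 1 (F n t) (F n.+1 t s).
Proof.
elim=> [|e D {}F e0 hD _ IH] n t s Us; first exact: is_derive_cst.
by apply: is_deriveD; [apply: is_deriveZ; exact: hD|exact: IH].
Qed.

Lemma NF_bounded U (c d : R) F n : 0 < d -> nbh c d `<=` U -> NF U F ->
  exists2 d', 0 < d' & exists M, near0 (fun t => forall s, nbh c d' s -> `|F n t s| <= M).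
Proof.
move=> d0 dU; elim=> [|e D {}F e0 hD _ [d1 d10 [M HM]]].
  by exists 1 => //; exists 0; apply: near0T => t _ s _; rewrite normr0.
have [d2 d20 [N HN]] := tower_bounded n d0 dU hD.
have [K HK] := powR_bounded e0.
exists (Num.min d1 d2); first by rewrite lt_min d10.
exists (K * N + M); apply: near0S2 HM HK => t HM HK s hs.
apply: le_trans (ler_normD _ _) _; apply: lerD.
  rewrite normrM; apply: ler_pM => //; apply: HN.
  by apply: nbh_le hs; rewrite ge_min lexx orbT.
by apply: HM; apply: nbh_le hs; rewrite ge_min lexx.
Qed.

Lemma NF_curve_bounded U (d : R) F n (y : R -> R) : 0 < d -> nbh (y 0) d `<=` U ->
  NF U F -> power_small (fun t => y t - y 0) -> bounded_curve (fun t => F n t (y t)).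
Proof.
move=> d0 dU hF yp; have [d' d'0 [M HM]] := NF_bounded n d0 dU hF.
by exists M; apply: near0S2 HM (power_small_lt yp d'0) => t HM /HM.
Qed.

Lemma NF_Ro U (d : R) F n (y : R -> R) : 0 < d -> nbh (y 0) d `<=` U ->
  NF U F -> in_Ro y -> in_Ro (fun t => F n t (y t)).
Proof.
move=> d0 dU hF ry; elim: hF => [|e D {}F e0 hD _ IH]; first exact: in_Ro_cst.
apply: in_RoD IH; apply: in_RoM; first exact: in_Ro_powR.
exact: tower_Ro d0 ry dU hD.
Qed.

Lemma NF_primitive (c d : R) F : 0 < d -> NF (nbh c d) F ->
  exists2 G, NF (nbh c (d / 2)) G & forall n, G n.+1 = F n.
Proof.
move=> d0; elim=> [|e D {}F e0 hD _ [G hG GE]].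
  by exists (fun _ _ _ => 0) => //; exact: NF_nil.
have [D' hD' DE] := tower_primitive d0 hD.
exists (fun n t s => t `^ e * D' n s + G n t s); first exact: NF_cons.
by move=> n; apply/funext => t; rewrite GE DE.
Qed.

(** Terms of equal exponent are merged, since coefficients can be read off from the values only when
    the exponents are distinct. *)
Lemma NF_collect U F : NF U F -> exists (E : seq R) (D : R -> nat -> R -> R),
  [/\ uniq E, all (fun e => 0 <= e) E, forall e, tower U (D e) &
      forall n t s, F n t s = \sum_(e <- E) t `^ e * D e n s].
Proof.
elim=> [|e D0 {}F e0 hD _ [E [D [uE E0 DT FE]]]].
  exists [::], (fun _ _ _ => 0); split => // [e n s Us|n t s]; last by rewrite big_nil.
  exact: is_derive_cst.
pose D' e' := if e' == e then (if e \in E then (fun n s => D0 n s + D e n s) else D0) else D e'.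
have D'T e' : tower U (D' e').
  rewrite /D'; case: ifP => _; last exact: DT.
  by case: ifP => _ //; exact: towerD.
have D'E E1 : e \notin E1 -> forall n t s, \sum_(a <- E1) t `^ a * D' a n s =
    \sum_(a <- E1) t `^ a * D a n s.
  move=> eE1 n t s; apply: eq_big_seq => a aE1; rewrite /D' ifN//.
  by apply: contraNneq eE1 => <-.
case: (boolP (e \in E)) => eE; last first.
  exists (e :: E), D'; split => //=; rewrite ?eE ?e0// => n t s.
  by rewrite big_cons D'E// -FE /D' eqxx (negPf eE).
exists E, D'; split => // n t s.
have nE1 : e \notin rem e E by rewrite rem_filter// mem_filter /= eqxx.
rewrite (big_rem e)//= D'E// {1}/D' eqxx eE FE (big_rem e)//=; ring.
Qed.

Lemma powR_sum_small (e0 : R) (E : seq R) (c : R -> R) :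
  (forall e, e \in E -> c e != 0 -> e0 < e) -> forall r : R, 0 < r ->
  near0 (fun t => 0 < t -> `|\sum_(e <- E) t `^ e * c e| <= r * t `^ e0).
Proof.
elim: E => [_ r r0|e E IH H r r0].
  by apply: near0T => t _ _; rewrite big_nil normr0 mulr_ge0// ?powR_ge0// ltW.
have {}IH := IH (fun a aE => H a (mem_behead (s := e :: E) aE)).
have [ce|ce] := eqVneq (c e) 0.
  by apply: near0S (IH _ r0) => t; rewrite big_cons ce mulr0 add0r.
have ee : 0 < e - e0 by rewrite subr_gt0 H// mem_head.
have r2 : 0 < r / 2 by lra.
have r3 : 0 < r / 2 / `|c e| by rewrite divr_gt0// normr_gt0.
apply: near0S2 (IH _ r2) (powR_small ee r3) => t h1 h2 t0.
rewrite big_cons (le_trans (ler_normD _ _))//.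
suff : `|t `^ e * c e| <= r / 2 * t `^ e0 by have := h1 t0; lra.
have -> : t `^ e = t `^ (e - e0) * t `^ e0.
  by rewrite -powRD ?subrK// (gt_eqF t0) implybT.
rewrite 2!normrM !(ger0_norm (powR_ge0 _ _)).
rewrite mulrAC ler_wpM2r ?powR_ge0// -ler_pdivlMr ?normr_gt0//.
Qed.

(** Otherwise let [e0 <= 1] be the least exponent with nonzero coefficient. Both the remaining terms
    and, since [t <= t ^ e0] for [t < 1], the whole sum are at most a third of [|c e0| * t ^ e0],
    which is impossible. *)
Lemma powR_sum_is_o (E : seq R) (c : R -> R) : uniq E ->
  is_o (fun t => \sum_(e <- E) t `^ e * c e) ->
  forall e, e \in E -> e <= 1 -> c e = 0.
Proof.
move=> uE o.
move=> e eE e1; apply/eqP; apply: contraT => ce.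
have ei : (index e E < size E)%N by rewrite index_mem.
have [] := @arg_minP _ R _ (Ordinal ei) (fun i => c E`_i != 0) (fun i => E`_i).
  by rewrite /= nth_index.
move=> i ci imin; set e0 := E`_i in ci.
have e0E : e0 \in E by exact: mem_nth.
have e01 : e0 <= 1.
  by apply: le_trans e1; have := imin (Ordinal ei); rewrite /= nth_index//; apply.
have H a : a \in rem e0 E -> c a != 0 -> e0 < a.
  rewrite rem_filter// mem_filter /= => /andP[ae aE] ca.
  have ai : (index a E < size E)%N by rewrite index_mem.
  rewrite lt_neqAle eq_sym ae /=.
  by have := imin (Ordinal ai); rewrite /= nth_index//; apply.
have r0 : 0 < `|c e0| / 3 by rewrite divr_gt0// normr_gt0.
have := near0S3 (fun t p q r => And3 p q r) (powR_sum_small H r0) (o _ r0) (near0_lt ltr01).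
move=> [d d0 /(_ (d / 2))]; have -> : 0 <= d / 2 < d by lra.
move=> /(_ isT)[]; have : 0 < d / 2 by lra.
move: (d / 2) => t t0 /(_ t0) h1 h2 /andP[_ t1].
have pt : 0 < t `^ e0 by rewrite powR_gt0.
have te : t <= t `^ e0 by apply: ger1_powR => //; rewrite t0 ltW.
have : `|c e0| * t `^ e0 <= 2 * (`|c e0| / 3) * t `^ e0.
  rewrite (_ : _ * _ = `|\sum_(e <- E) t `^ e * c e - \sum_(e <- rem e0 E) t `^ e * c e|).
    apply: le_trans (ler_normB _ _) _.
    have : `|c e0| / 3 * t <= `|c e0| / 3 * t `^ e0 by rewrite ler_pM2l.
    lra.
  by rewrite (big_rem e0)//= addrK normrM mulrC (ger0_norm (powR_ge0 _ _)).
by rewrite ler_pM2r// => ?; lra.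
Qed.

Lemma is_derive_zero (f : R -> R) (s df e : R) : 0 < e ->
  (forall x, nbh s e x -> f x = 0) -> is_derive s 1 f df -> df = 0.
Proof.
move=> e0 f0 h; have h0 : is_derive s 1 (fun=> 0 : R) df.
  apply: near_eq_is_derive h; exists e => // x /= xs; apply: f0; by rewrite /nbh /= distrC.
have : is_derive s 1 (fun=> 0 : R) 0 by exact: is_derive_cst.
by move=> /@derive_val <-; move: h0 => /@derive_val <-.
Qed.

(** The point [c] may be an end of the interval: all derivatives vanish inside, and continuity
    carries this to [c]. *)
Lemma tower_vanish (c d a b : R) D : 0 < d -> tower (nbh c d) D -> a < b -> a <= c <= b ->
  (forall s, a < s < b -> nbh c d s -> D 0%N s = 0) -> forall k, D k c = 0.
Proof.
move=> d0 hD ab /andP[ac cb] H k.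
have {H} H s : a < s < b -> nbh c d s -> D k s = 0.
  elim: k s => [|k IH] s; first exact: H.
  move=> /andP[sa sb] sd; have [d' d'0 hd'] := nbh_move sd.
  have e0 : 0 < Num.min d' (Num.min (s - a) (b - s)) by rewrite !lt_min d'0 !subr_gt0 sa.
  apply: is_derive_zero e0 _ (hD k s sd) => x xs; apply: IH; last first.
    by apply: hd'; apply: nbh_le xs; rewrite ge_min lexx.
  move: xs; rewrite /nbh /= !lt_min ltr_norml => /andP[_ /andP[]].
  by rewrite !ltr_norml => /andP[? ?] /andP[? ?]; apply/andP; split; lra.
apply/eqP; apply: contraT => Dc; have Dc0 : 0 < `|D k c| by rewrite normr_gt0.
have /is_derive_continuous/cvgrPdist_lt/(_ _ Dc0) := hD k c (nbh_center c d0).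
move=> [e /= e0 He].
have [m [m0 md me mb]] : exists m : R, [/\ 0 < m, m < d, m < e & m < (b - a) / 2].
  exists (Num.min (Num.min d e) ((b - a) / 2) / 2).
  have h1 : Num.min (Num.min d e) ((b - a) / 2) <= d by rewrite !ge_min lexx.
  have h2 : Num.min (Num.min d e) ((b - a) / 2) <= e by rewrite !ge_min lexx orbT.
  have h3 : Num.min (Num.min d e) ((b - a) / 2) <= (b - a) / 2 by rewrite ge_min lexx orbT.
  have h4 : 0 < Num.min (Num.min d e) ((b - a) / 2).
    by rewrite !lt_min d0 e0 divr_gt0// subr_gt0.
  by split; lra.
(* As [m] is below half the length of the interval, [c + m] or [c - m] lies strictly inside. *)
pose s := if c + m < b then c + m else c - m.
have sm : `|s - c| = m.
  rewrite /s; case: ifP => _; first by rewrite addrAC subrr add0r gtr0_norm.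
  by rewrite addrAC subrr add0r normrN gtr0_norm.
have := He s; rewrite /= distrC sm => /(_ me).
have sd : nbh c d s by rewrite /nbh /= sm.
rewrite (H _ _ sd) ?subr0 ?ltxx//.
by rewrite /s; case: (ltP (c + m) b) => h; apply/andP; split; lra.
Qed.

Lemma is_o_sum_seq (E : seq R) (w : R -> R -> R) :
  (forall e, e \in E -> is_o (w e)) -> is_o (fun t => \sum_(e <- E) w e t).
Proof.
elim: E => [_|e E IH H]; first by apply: is_o_ext (@is_o0 R) => t _; rewrite big_nil.
apply: is_o_ext (is_oD (H e (mem_head _ _)) (IH _)) => [t _|a aE]; first by rewrite big_cons.
by apply: H; rewrite inE aE orbT.
Qed.

(* One-sided vanishing kills every derivative of the coefficients at [c], hence, by Taylor, the
   values at points infinitely close to [c] on either side. *)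
Lemma NF_vanish (c d a b : R) F : 0 < d -> NF (nbh c d) F -> a < b -> a <= c <= b ->
  (forall s, a < s < b -> nbh c d s -> is_o (fun t => F 0%N t s)) ->
  forall n y, power_small (fun t => y t - c) -> is_o (fun t => F n t (y t)).
Proof.
move=> d0 hF ab cab side n y yp.
have [E [D [uE E0 DT FE]]] := NF_collect hF.
apply: (@is_o_ext _ _ (fun t => \sum_(e <- E) t `^ e * D e n (y t))) => [t _|]; first exact: FE.
have D0 e : e \in E -> e <= 1 -> forall k, D e k c = 0.
  move=> eE e1; apply: tower_vanish d0 (DT e) ab cab _ => s sab sd.
  apply: (powR_sum_is_o uE (c := fun e => D e 0%N s)) eE e1.
  by apply: is_o_ext (side s sab sd) => t _; rewrite FE.
apply: is_o_sum_seq => e eE.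
have ep := allP E0 _ eE; case: (leP e 1) => e1.
  apply: is_oM; first exact: powR_bounded.
  have [N /(_ N (leqnn N)) oN] := yp.
  have [d1 d10 [M HM]] := tower_bounded (n + N) d0 (fun s h => h) (DT e).
  have := is_oM (bounded_cst M) oN; apply: is_o_le.
  apply: near0S2 (power_small_lt yp d0) (power_small_lt yp d10) => t yd yd1.
  rewrite normrM normrX.
  apply: (@le_trans _ _ (M * `|y t - c| ^+ N)); last first.
    by rewrite ler_wpM2r ?ler_norm ?exprn_ge0.
  apply: le_trans (@taylor_le _ (fun k => D e (n + k)%N) N c (y t) M _ _).
  - rewrite addn0 big1 ?subr0// => k _; by rewrite D0// !mul0r.
  - move=> k z _ zy; rewrite addnS; apply: DT; exact: le_lt_trans yd.
  - move=> z zy; apply: HM; exact: le_lt_trans yd1.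
(* For [e > 1] the power is itself o(t), and a bounded coefficient is enough. *)
have [d1 d10 [M HM]] := tower_bounded n d0 (fun s h => h) (DT e).
have bD : bounded_curve (fun t => D e n (y t)).
  by exists M; apply: near0S (power_small_lt yp d10) => t /HM.
by apply: is_o_ext (is_oM bD (powR_is_o e1)) => t _; rewrite mulrC.
Qed.

(** The coefficients with [e <= 1] have zero derivative on the part of [[a, b]] inside the
    neighbourhood, hence are constant there. So [freeze c2 F] vanishes at standard points, and
    [NF_vanish] extends this to curves infinitely close to [c1]. *)
Lemma NF_const (c d a b c1 c2 : R) F (y1 : R -> R) : NF (nbh c d) F -> a < b ->
  (forall s, a < s < b -> nbh c d s -> is_o (fun t => F 1%N t s)) ->
  a <= c1 <= b -> nbh c d c1 -> a <= c2 <= b -> nbh c d c2 ->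
  power_small (fun t => y1 t - c1) -> is_o (fun t => F 0%N t (y1 t) - F 0%N t c2).
Proof.
move=> hF ab F1 ac1 c1d ac2 c2d yp.
have [E [D [uE E0 DT FE]]] := NF_collect hF.
have D1 e : e \in E -> e <= 1 -> forall z, a <= z <= b -> nbh c d z -> D e 1%N z = 0.
  move=> eE e1 z zab zd; have [d' d'0 hd'] := nbh_move zd.
  apply: (tower_vanish d'0 _ ab zab _ 0%N (D := fun n => D e n.+1)).
    by apply: tower_shift; apply: tower_sub hd' (DT e).
  move=> s sab /hd' sd; apply: (powR_sum_is_o uE (c := fun e => D e 1%N s)) eE e1.
  by apply: is_o_ext (F1 s sab sd) => t _; rewrite FE.
have [d1 d10 hd1] := nbh_move c1d.
have vanish s : a < s < b -> nbh c1 d1 s -> is_o (fun t => freeze c2 F 0%N t s).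
  move=> /andP[sa sb] /hd1 sd; rewrite /freeze.
  apply: (@is_o_ext _ _ (fun t => \sum_(e <- E) t `^ e * (D e 0%N s - D e 0%N c2))).
    by move=> t _; rewrite !FE -sumrB; apply: eq_bigr => e _; rewrite mulrBr.
  apply: is_o_sum_seq => e eE; case: (leP e 1) => e1; last first.
    by apply: is_o_ext (is_oM (bounded_cst _) (powR_is_o e1)) => t _; rewrite mulrC.
  have -> : D e 0%N s = D e 0%N c2.
    have I u v : u <= v -> a <= u -> v <= b -> nbh c d u -> nbh c d v ->
        D e 0%N v = D e 0%N u.
      rewrite /nbh /= !ltr_norml => uv au vb /andP[u1 u2] /andP[v1 v2].
      have N z : u <= z <= v -> nbh c d z.
        by move=> /andP[z1 z2]; rewrite /nbh /= ltr_norml; apply/andP; split; lra.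
      have [|z zi /eqP] := @mvt _ (D e 0%N) (D e 1%N) u v uv.
        by move=> z /N; exact: DT.
      rewrite D1//; last exact: N.
        by rewrite mul0r subr_eq0 => /eqP.
      by move: zi => /andP[z1 z2]; apply/andP; split; lra.
    case/andP: ac2 => a2 b2; case: (leP s c2) => [sc|/ltW sc].
      by rewrite [RHS](I s)// ltW.
    by apply: I => //; exact: ltW.
  by apply: is_o_ext (@is_o0 R) => t _; rewrite subrr mulr0.
exact: NF_vanish d10 (NF_sub hd1 (NF_freeze c2 hF)) ab ac1 vanish 0%N _ yp.
Qed.

(** Uniformity in [s] is what permits evaluation along a curve [y t] instead of at a fixed point. *)
Definition unif_o U (B : R -> R -> R) :=
  forall e : R, 0 < e -> near0 (fun t => forall s, U s -> `|B t s| <= e * t).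

Lemma unif_o_curve (c d : R) B (y : R -> R) : 0 < d -> unif_o (nbh c d) B ->
  power_small (fun t => y t - c) -> is_o (fun t => B t (y t)).
Proof.
move=> d0 h yp e e0; apply: near0S2 (h _ e0) (power_small_lt yp d0) => t H; exact: H.
Qed.

Lemma unif_o_pt U B (s : R) : unif_o U B -> U s -> is_o (fun t => B t s).
Proof. by move=> h Us e e0; apply: near0S (h _ e0) => t; apply. Qed.

Lemma unif_o_sub U U' B : U' `<=` U -> unif_o U B -> unif_o U' B.
Proof. by move=> UU h e e0; apply: near0S (h _ e0) => t H s /UU; exact: H. Qed.

(* Only values are controlled by the hypotheses: the derivatives are compared through a primitive
   of their difference, whose coefficients turn out to be constant. *)
Lemma NF_derive_unique (c d : R) (A A' : R -> R -> R) F G (y : R -> R) : 0 < d ->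
  NF (nbh c d) F -> NF (nbh c d) G ->
  near0 (fun t => forall s, nbh c d s -> is_derive s 1 (A t) (A' t s)) ->
  unif_o (nbh c d) (fun t s => A t s - F 0%N t s) ->
  unif_o (nbh c d) (fun t s => A' t s - G 0%N t s) ->
  power_small (fun t => y t - c) -> is_o (fun t => A' t (y t) - F 1%N t (y t)).
Proof.
move=> d0 hF hG dA uF uG yp.
have [H hH HE] := NF_primitive d0 (NFB (NF_shift hF) hG).
have d20 : 0 < d / 2 by lra.
have dd : nbh c (d / 2) `<=` nbh c d by apply: nbh_le; lra.
have vanish s : nbh c (d / 2) s -> is_o (fun t => freeze c H 0%N t s).
  move=> sd; rewrite /freeze.
  (* Its [s]-derivative is [A' - G], which is uniformly o(t), so by the mean value inequality [B] is
     constant in [s] up to o(t). *)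
  pose B t s := A t s - F 0%N t s + H 0%N t s.
  have oB : is_o (fun t => B t s - B t c).
    move=> e e0; apply: near0S3 dA (uG _ (divr_gt0 e0 d0)) (near0_lt ltr01) => t hA hB /andP[t0 _].
    apply: le_trans (@mvt_le _ _ (fun s => A' t s - G 0%N t s) c s (e / d * t) _ _) _.
    - move=> z zs; have zd2 : nbh c (d / 2) z by exact: le_lt_trans sd.
      have zd := dd _ zd2.
      apply: is_derive_eq (is_deriveD (is_deriveB (hA z zd) (NF_derive hF 0%N t zd))
        (NF_derive hH 0%N t zd2)) _.
      by rewrite HE; ring.
    - by move=> z zs; apply: hB; apply: dd; exact: le_lt_trans sd.
    - rewrite -mulrA [t * _]mulrC mulrA ler_wpM2r//.
      rewrite mulrAC ler_pdivrMr// ler_pM2l//; apply: le_trans (ltW sd) _; lra.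
  apply: is_o_ext (is_oD (is_oB oB (unif_o_pt uF (dd _ sd))) (unif_o_pt uF (nbh_center c d0))).
  by move=> t _; rewrite /B; ring.
have ab : c < c + 1 by lra.
have cab : c <= c <= c + 1 by apply/andP; split; lra.
have := NF_vanish d20 (NF_freeze c hH) ab cab (fun s _ => vanish s) 1%N yp.
rewrite /freeze HE => h; apply: is_o_ext (is_oB (unif_o_curve d0 uG yp) h) => t _.
by ring.
Qed.

End NormalForms.

(** * Functions that are normal forms up to a uniform o(t) *)

Section UniformNF.
Variable R : realType.
Implicit Types (B : R -> R -> R) (F : nat -> R -> R -> R).

Lemma unif_oD (U : set R) B B' : unif_o U B -> unif_o U B' -> unif_o U (fun t s => B t s + B' t s).
Proof.
move=> h h' e e0; have e2 : 0 < e / 2 by lra.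
apply: near0S2 (h _ e2) (h' _ e2) => t h1 h2 s Us.
by apply: le_trans (ler_normD _ _) _; have := h1 s Us; have := h2 s Us; lra.
Qed.

Lemma unif_o_ext (U : set R) B B' : (forall t s, B' t s = B t s) -> unif_o U B -> unif_o U B'.
Proof. by move=> E h e /h; apply: near0S => t H s; rewrite E; exact: H. Qed.

Definition uNF (c : R) B := exists2 d, 0 < d &
  exists2 F, NF (nbh c d) F & unif_o (nbh c d) (fun t s => B t s - F 0%N t s).

Lemma uNF_unif_o (c d : R) B B' : 0 < d -> unif_o (nbh c d) (fun t s => B t s - B' t s) ->
  uNF c B' -> uNF c B.
Proof.
move=> d0 h [d' d'0 [F hF uF]].
have l1 : nbh c (Num.min d d') `<=` nbh c d by apply: nbh_le; rewrite ge_min lexx.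
have l2 : nbh c (Num.min d d') `<=` nbh c d' by apply: nbh_le; rewrite ge_min lexx orbT.
exists (Num.min d d'); first by rewrite lt_min d0.
exists F; first exact: NF_sub hF.
apply: unif_o_ext (unif_oD (unif_o_sub l1 h) (unif_o_sub l2 uF)) => t s; ring.
Qed.

Lemma uNFD (c : R) B B' : uNF c B -> uNF c B' -> uNF c (fun t s => B t s + B' t s).
Proof.
move=> [d d0 [F hF uF]] [d' d'0 [G hG uG]].
have l1 : nbh c (Num.min d d') `<=` nbh c d by apply: nbh_le; rewrite ge_min lexx.
have l2 : nbh c (Num.min d d') `<=` nbh c d' by apply: nbh_le; rewrite ge_min lexx orbT.
exists (Num.min d d'); first by rewrite lt_min d0.
exists (fun n t s => F n t s + G n t s); first exact: NFD (NF_sub l1 hF) (NF_sub l2 hG).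
apply: unif_o_ext (unif_oD (unif_o_sub l1 uF) (unif_o_sub l2 uG)) => t s; ring.
Qed.

Lemma uNF0 (c : R) : uNF c (fun _ _ => 0).
Proof.
exists 1 => //; exists (fun _ _ _ => 0); first exact: NF_nil.
by move=> e e0; apply: near0T => t t0 s _; rewrite subr0 normr0 mulr_ge0// ltW.
Qed.

Lemma NF_powM (U : set R) (a : R) F : 0 <= a -> NF U F ->
  NF U (fun n t s => t `^ a * F n t s).
Proof.
move=> a0; elim=> [|e D {}F e0 hD _ IH].
  by apply: NF_ext (NF_nil U) _ => n t s; rewrite mulr0.
apply: NF_ext (NF_cons (addr_ge0 a0 e0) hD IH) _ => n t s.
by rewrite powRD_ge0//; ring.
Qed.

Lemma NF_listM (U : set R) (l : seq (R * R)) F : all (fun p => 0 <= p.1) l -> NF U F ->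
  NF U (fun n t s => (\sum_(p <- l) p.2 * t `^ p.1) * F n t s).
Proof.
move=> + hF; elim: l => [_|p l IH /= /andP[p0 /IH hl]].
  by apply: NF_ext (NF_nil U) _ => n t s; rewrite big_nil mul0r.
apply: NF_ext (NFD (NFZ p.2 (NF_powM p0 hF)) hl) _ => n t s.
by rewrite big_cons; ring.
Qed.

Lemma unif_o_mul (U : set R) w B (M : R) : is_o w ->
  near0 (fun t => forall s, U s -> `|B t s| <= M) -> unif_o U (fun t s => w t * B t s).
Proof.
move=> ow HM e e0; set N := `|M| + 1.
have N0 : 0 < N by rewrite /N; have := normr_ge0 M; lra.
apply: near0S3 HM (ow _ (divr_gt0 e0 N0)) (near0_lt ltr01) => t hM hw /andP[t0 _] s Us.
rewrite normrM (_ : e * t = e / N * t * N); last by field; rewrite gt_eqF.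
apply: ler_pM => //; apply: le_trans (hM s Us) _.
by rewrite /N; have := ler_norm M; lra.
Qed.

Lemma unif_o_bounded_mul (U : set R) w B : bounded_curve w ->
  unif_o U B -> unif_o U (fun t s => w t * B t s).
Proof.
move=> [M hM] uB e e0; set N := `|M| + 1.
have N0 : 0 < N by rewrite /N; have := normr_ge0 M; lra.
apply: near0S2 hM (uB _ (divr_gt0 e0 N0)) => t hw hB s Us.
rewrite normrM (_ : e * t = N * (e / N * t)); last by field; rewrite gt_eqF.
apply: ler_pM => //; last exact: hB.
by apply: le_trans hw _; rewrite /N; have := ler_norm M; lra.
Qed.

(** The error of [w] is multiplied by the bounded [F], that of [B] by the bounded [w]; both products
    remain uniformly o(t). *)
Lemma uNF_RoM (c : R) w B : in_Ro w -> uNF c B -> uNF c (fun t s => w t * B t s).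
Proof.
move=> rw [d d0 [F hF uF]]; have [l l0 ol] := (in_RoP w).1 rw.
have [d1 d10 [M HM]] := NF_bounded 0%N d0 (fun s h => h) hF.
have l1 : nbh c (Num.min d d1) `<=` nbh c d by apply: nbh_le; rewrite ge_min lexx.
have l2 : nbh c (Num.min d d1) `<=` nbh c d1 by apply: nbh_le; rewrite ge_min lexx orbT.
exists (Num.min d d1); first by rewrite lt_min d0.
exists (fun n t s => (\sum_(p <- l) p.2 * t `^ p.1) * F n t s).
  exact: NF_listM l0 (NF_sub l1 hF).
have HM' : near0 (fun t => forall s, nbh c (Num.min d d1) s -> `|F 0%N t s| <= M).
  by apply: near0S HM => t H s /l2; exact: H.
apply: unif_o_ext (unif_oD (unif_o_bounded_mul (in_Ro_bounded rw) (unif_o_sub l1 uF)) (unif_o_mul ol HM')).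
by move=> t s; ring.
Qed.

Lemma uNF_sum (c : R) n (B : 'I_n -> R -> R -> R) : (forall i, uNF c (B i)) ->
  uNF c (fun t s => \sum_(i < n) B i t s).
Proof.
move=> H; rewrite (_ : (fun _ _ => _) = (fun t s => \sum_(i <- index_enum 'I_n) B i t s))//.
elim: (index_enum _) => [|i r IH].
  have := uNF0 c; congr uNF; apply/funext => t; apply/funext => s.
  by rewrite big_nil.
have := uNFD (H i) IH; congr uNF; apply/funext => t; apply/funext => s.
by rewrite big_cons.
Qed.

End UniformNF.

(** * Directional derivatives as derivatives along lines *)

Section Lines.
Variables (R : realType) (k : nat).
Implicit Types (f : 'rV[R]_k -> R) (z v : 'rV[R]_k).

(** The two difference quotients agree as functions of [h], so derivability and the value of the
    derivative transfer in both directions. *)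
Lemma derive_line_fun f z v (h0 : R) :
  (fun h : R => h^-1 *: ((f \o shift (z + h0 *: v)) (h *: v) - f (z + h0 *: v))) =
  (fun h : R => h^-1 *: (((fun u : R => f (z + u *: v)) \o shift h0) (h *: (1 : R)) -
     f (z + h0 *: v))).
Proof.
apply/funext => h /=; congr (_ *: (f _ - _)).
by rewrite [h *: (1 : R)]mulr1 scalerDl addrCA.
Qed.

Lemma is_derive_line f z v (h : R) : derivable f (z + h *: v) v ->
  is_derive h 1 (fun u : R => f (z + u *: v)) ('D_v f (z + h *: v)).
Proof.
move=> df; split.
  by rewrite /derivable -derive_line_fun.
by rewrite /derive -derive_line_fun.
Qed.

Lemma line_is_derive f z v (df : R) : is_derive (0 : R) 1 (fun u : R => f (z + u *: v)) df ->
  is_derive z v f df.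
Proof.
move=> [d1 d2]; have E := derive_line_fun f z v 0; rewrite scale0r addr0 in E.
split.
  by rewrite /derivable E; move: d1; rewrite /derivable scale0r addr0.
by rewrite /derive E; move: d2; rewrite /derive scale0r addr0.
Qed.

(** [Cn] recurses on the total function ['D_v f], whose closed form is in general known only on [U];
    openness makes agreement on [U] an agreement near each point. *)
Lemma Cn_ext (n : nat) (U : set 'rV[R]_k) f g : open U -> (forall z, U z -> f z = g z) ->
  Cn n U f -> Cn n U g.
Proof.
move=> oU; have ev_eq h1 h2 z : (forall z, U z -> h1 z = h2 z) -> U z ->
    \near z, h1 z = h2 z :> R.
  move=> E Uz; have : nbhs z U by apply: open_nbhs_nbhs.
  by apply: filterS => y /E.
elim: n f g => [|n IH] f g E /=.
  move=> H z Uz; have := H z Uz; rewrite /prop_for/continuous_at -E// => h.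
  apply: cvg_trans h; apply: near_eq_cvg; first exact: nbhs_filter.
  by apply: filterS (ev_eq _ _ _ E Uz) => y ->.
move=> [H0 H]; split.
  move=> z Uz; have := H0 z Uz; rewrite /prop_for/continuous_at -E// => h.
  apply: cvg_trans h; apply: near_eq_cvg; first exact: nbhs_filter.
  by apply: filterS (ev_eq _ _ _ E Uz) => y ->.
move=> i; have [H1 H2] := H i; split.
  by move=> z Uz; apply: near_eq_derivable (ev_eq _ _ _ E Uz) (H1 z Uz).
apply: IH H2 => z Uz; apply: near_eq_derive; exact: ev_eq.
Qed.

End Lines.

(** * Expansion of local representations *)

Section TaylorInParameters.
Variables (R : realType) (q : nat).
Implicit Types (P : set 'rV[R]_q) (V : set R) (K : 'rV[R]_(q + 1) -> R).
Implicit Types (w : 'rV[R]_q) (s : R).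

Definition mkpt w s : 'rV[R]_(q + 1) := row_mx w (\row_(j < 1) s).

Lemma mkpt_lsub w s : lsubmx (mkpt w s) = w.
Proof. by rewrite /mkpt row_mxKl. Qed.

Lemma mkpt_rsub w s : rsubmx (mkpt w s) ord0 ord0 = s.
Proof. by rewrite /mkpt row_mxKr mxE. Qed.

Lemma mkpt_left w s (h : R) i :
  mkpt w s + h *: delta_mx 0 (lshift 1 i) = mkpt (w + h *: delta_mx 0 i) s.
Proof. by rewrite delta_mx_lshift /mkpt scale_row_mx add_row_mx scaler0 addr0. Qed.

Lemma mkpt_right w s (h : R) :
  mkpt w s + h *: delta_mx 0 (rshift q (ord0 : 'I_1)) = mkpt w (s + h).
Proof.
rewrite delta_mx_rshift /mkpt scale_row_mx add_row_mx scaler0 addr0; congr row_mx.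
by apply/matrixP => i j; rewrite [i]ord1 [j]ord1 !mxE /= mulr1.
Qed.

Lemma Cinfty_derive (k : nat) (U : set 'rV[R]_k) (G : 'rV[R]_k -> R) i : Cinfty U G ->
  Cinfty U ('D_(delta_mx 0 i) G).
Proof. by move=> h n; have [_ /(_ i)[_]] := h n.+1. Qed.

Lemma Cinfty_derivable (k : nat) (U : set 'rV[R]_k) (G : 'rV[R]_k -> R) i z :
  Cinfty U G -> U z -> derivable G z (delta_mx 0 i).
Proof. by move=> h Uz; have [_ /(_ i)[+ _]] := h 1%N; exact. Qed.

Lemma Cinfty_continuous (k : nat) (U : set 'rV[R]_k) (G : 'rV[R]_k -> R) z :
  Cinfty U G -> U z -> {for z, continuous G}.
Proof. by move=> h Uz; exact: (h 0%N). Qed.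

Definition box (w0 : 'rV[R]_q) (c r : R) : set 'rV[R]_(q + 1) :=
  [set z | exists w s, [/\ z = mkpt w s, forall i, `|w 0 i - w0 0 i| < r & `|s - c| < r]].

Lemma box_le w0 (c r r' : R) : r <= r' -> box w0 c r `<=` box w0 c r'.
Proof.
move=> rr z [w [s [-> h1 h2]]]; exists w, s; split => // [i|]; exact: lt_le_trans rr.
Qed.

Lemma open_box P V w0 (c : R) : open P -> open V -> P w0 -> V c ->
  exists2 r, 0 < r & box w0 c r `<=` prodPV P V.
Proof.
move=> oP oV Pw Vc.
have /nbhs_ballP[r /= r0 hr] : nbhs w0 P by apply: open_nbhs_nbhs.
have /nbhs_ballP[r' /= r'0 hr'] : nbhs c V by apply: open_nbhs_nbhs.
exists (Num.min r r'); first by rewrite lt_min r0.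
move=> _ [w [s [-> h1 h2]]]; rewrite /prodPV /= mkpt_lsub mkpt_rsub; split.
  apply: hr; split => // i j; rewrite [i]ord1 /ball /= distrC.
  by apply: lt_le_trans (h1 j) _; rewrite ge_min lexx.
by apply: hr'; rewrite /ball /= distrC; apply: lt_le_trans h2 _; rewrite ge_min lexx orbT.
Qed.

Lemma box_bounded K w0 (c : R) : {for mkpt w0 c, continuous K} ->
  exists2 r, 0 < r & exists M, forall z, box w0 c r z -> `|K z| <= M.
Proof.
move=> /cvgrPdist_le /(_ _ ltr01) /nbhs_ballP[r /= r0 hr].
exists r => //; exists (1 + `|K (mkpt w0 c)|) => _ [w [s [-> h1 h2]]].
have : `|K (mkpt w0 c) - K (mkpt w s)| <= 1.
  apply: (hr (mkpt w s)); split => // i j; rewrite [i]ord1 /mkpt.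
  rewrite -[j]fintype.splitK; case: (fintype.split j) => j' /=.
    by rewrite !row_mxEl /ball /= distrC.
  by rewrite !row_mxEr !mxE /ball /= distrC.
have := ler_normD (K (mkpt w s) - K (mkpt w0 c)) (K (mkpt w0 c)); rewrite subrK distrC; lra.
Qed.

Definition mixed (m : nat) w w0 : 'rV[R]_q := \row_i (if (i < m)%N then w 0 i else w0 0 i).

Lemma mixed0 w w0 : mixed 0 w w0 = w0.
Proof. by apply/rowP => i; rewrite mxE. Qed.

Lemma mixed_full w w0 : mixed q w w0 = w.
Proof. by apply/rowP => i; rewrite mxE ltn_ord. Qed.

Lemma mixedS w w0 (i : 'I_q) :
  mixed i.+1 w w0 = mixed i w w0 + (w 0 i - w0 0 i) *: delta_mx 0 i.
Proof.
apply/rowP => j; rewrite !mxE eqxx /= ltnS leq_eqVlt.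
case: (eqVneq j i) => [->|ji]; first by rewrite eqxx ltnn mulr1; ring.
by rewrite (inj_eq val_inj) (negPf ji) /= mulr0 addr0.
Qed.

Lemma near0_all (I : finType) (Q : I -> R -> Prop) :
  (forall i, near0 (Q i)) -> near0 (fun t => forall i, Q i t).
Proof.
move=> H; have : near0 (fun t => forall i, i \in enum I -> Q i t).
  elim: (enum I) => [|i l IH]; first exact: near0T.
  by apply: near0S2 (H i) IH => t qi ql j; rewrite inE => /predU1P[->|/ql].
by apply: near0S => t h i; apply: h; rewrite mem_enum.
Qed.

(* Taylor expansion in one parameter at a time: in [mixed m] the first [m] parameters move and the
   others are frozen at their standard parts. *)
Lemma uNF_smooth P V (c : R) (x : R -> 'rV[R]_q) K : open P -> open V -> P (x 0) -> V c ->
  (forall i, in_Ro (fun t => x t 0 i)) -> Cinfty (prodPV P V) K ->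
  uNF c (fun t s => K (mkpt (x t) s)).
Proof.
move=> oP oV Px Vc rx; set w0 := x 0.
have [r r0 rU] := open_box oP oV Px Vc.
(* [K] is generalized because the Taylor coefficients are partial derivatives of [K], to which the
   induction hypothesis is applied. *)
suff H m : (m <= q)%N -> forall K, Cinfty (prodPV P V) K ->
    uNF c (fun t s => K (mkpt (mixed m (x t) w0) s)).
  move=> hK; have := H q (leqnn q) K hK.
  by congr uNF; apply/funext => t; rewrite mixed_full.
elim: m => [_ {}K hK|m IH mq {}K hK].
  (* With all parameters frozen, [K] is an ordinary smooth function of [s]: a single term with
     exponent 0 and no error. *)
  pose D n s := iter n (fun G => 'D_(delta_mx 0 (rshift q (ord0 : 'I_1))) G) K (mkpt w0 s).
  have CD n : Cinfty (prodPV P V)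
      (iter n (fun G => 'D_(delta_mx 0 (rshift q (ord0 : 'I_1))) G) K).
    by elim: n => [//|n IHn]; exact: Cinfty_derive.
  have hD : tower (nbh c r) D.
    move=> n s sr; rewrite /D /=.
    have inU : prodPV P V (mkpt w0 s).
      by apply: rU; exists w0, s; split => // i; rewrite subrr normr0.
    have := @is_derive_line _ _ (iter n (fun G => 'D_(delta_mx 0 (rshift q (ord0 : 'I_1))) G) K)
      (mkpt w0 0) (delta_mx 0 (rshift q (ord0 : 'I_1))) s.
    rewrite mkpt_right add0r => /(_ (Cinfty_derivable (CD n) inU)).
    congr is_derive; apply/funext => u; by rewrite mkpt_right add0r.
  exists r => //; exists (fun n t s => t `^ 0 * D n s); first exact: NF_single.
  move=> e e0; apply: near0T => t t0 s _; rewrite powRr0 mul1r mixed0 /D /= subrr normr0.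
  by rewrite mulr_ge0// ltW.
pose i := Ordinal mq; pose ei := delta_mx 0 (lshift 1 i) : 'rV[R]_(q + 1).
pose DK n := iter n (fun G => 'D_ei G) K.
have CD n : Cinfty (prodPV P V) (DK n).
  by elim: n => [//|n IHn]; exact: Cinfty_derive.
pose pi t := x t 0 i - w0 0 i.
have pip : power_small pi by exact: in_Ro_power_small (rx i).
(* The order of the expansion: the [N]-th power of the increment of the parameter is o(t). *)
have [N /(_ N (leqnn N)) oN] := pip.
have Uc : prodPV P V (mkpt w0 c).
  by apply: rU; exists w0, c; split => // [j|]; rewrite subrr normr0.
have [r1 r10 [M HM]] := box_bounded (Cinfty_continuous (CD N) Uc).
pose r2 := Num.min r r1; have r20 : 0 < r2 by rewrite lt_min r0.
have xr2 : near0 (fun t => forall i, `|x t 0 i - w0 0 i| < r2).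
  by apply: near0_all => j; apply: power_small_lt r20; exact: in_Ro_power_small (rx j).
(* Taylor polynomial in the [i]-th parameter: each term is a little-oh polynomial times a derivative
   of [K] with one moving parameter fewer. *)
apply: (@uNF_unif_o _ c r2 _ (fun t s => \sum_(n < N)
    (pi t ^+ n / n`!%:R) * DK n (mkpt (mixed m (x t) w0) s))) => //; last first.
  apply: uNF_sum => n; apply: uNF_RoM; last by apply: IH => //; exact: ltnW.
  have := in_RoZ (n`!%:R^-1) (in_RoX n (in_RoB (rx i) (in_Ro_cst (w0 0 i)))).
  by congr in_Ro; apply/funext => t; rewrite mulrC.
move=> e e0; have oM := is_oM (bounded_cst M) oN e0.
apply: near0S2 xr2 oM => t xt hM s sr2.
apply: le_trans hM; rewrite normrM normrX.
apply: (@le_trans _ _ (M * `|pi t| ^+ N)); last first.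
  by rewrite ler_wpM2r ?exprn_ge0// ler_norm.
(* The [i]-th entry of [mixed m] is still frozen, so adding [h] moves it by at most [|pi t|], which
   is below [r2]. *)
have line h : `|h| <= `|pi t| -> box w0 c r2 (mkpt (mixed m (x t) w0) s + h *: ei).
  move=> hpi; rewrite /ei mkpt_left; exists (mixed m (x t) w0 + h *: delta_mx 0 i), s.
  split => // j; rewrite !mxE eqxx /=.
  case: (eqVneq j i) => [->|ji] /=.
    rewrite ltnn mulr1 addrAC subrr add0r; exact: le_lt_trans (xt i).
  by rewrite mulr0 addr0; case: ifP => _; [exact: xt|rewrite subrr normr0].
have := @taylor_le _ (fun n h => DK n (mkpt (mixed m (x t) w0) s + h *: ei)) N 0 (pi t) M.
have ES : mixed m.+1 (x t) w0 = mixed m (x t) w0 + pi t *: delta_mx 0 i.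
  exact: (mixedS _ _ i).
rewrite /= subr0 {1}/ei mkpt_left -ES => H.
apply: le_trans (H _ _) => {H}; last first.
- move=> h; rewrite subr0 => /line hb; apply: HM; apply: box_le hb.
  by rewrite ge_min lexx orbT.
- move=> n h _; rewrite subr0 => /line hb; apply: is_derive_line.
  apply: Cinfty_derivable (CD n) _; apply: rU; apply: box_le hb.
  by rewrite ge_min lexx.
rewrite le_eqVlt; apply/orP; left; apply/eqP; congr `|_ - _|.
by apply: eq_bigr => n _; rewrite scale0r addr0; ring.
Qed.

End TaylorInParameters.

(** * Functions affine in the parameters *)

Section Linear.
Variables (R : realType) (q : nat).
Implicit Types (V : set R) (A : 'I_q -> nat -> R -> R) (B : nat -> R -> R).
Implicit Types (z : 'rV[R]_(q + 1)).

Let zl z : R := z 0 (rshift q (ord0 : 'I_1)).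

(** The summand [B] closes this class under all partial derivatives: the one in the [i]-th parameter
    is [A i], free of parameters. *)
Definition lin A B z : R := \sum_(j < q) z 0 (lshift 1 j) * A j 0%N (zl z) + B 0%N (zl z).

Lemma is_derive_shift0 (f : R -> R) (a df : R) : is_derive a 1 f df ->
  is_derive (0 : R) 1 (fun u => f (a + u)) df.
Proof.
move=> h; have h' : is_derive (a + 0) 1 f df by rewrite addr0.
have g : is_derive (0 : R) 1 (fun u : R => a + u) 1.
  by rewrite -[X in is_derive _ _ _ X]add0r; apply: is_deriveD.
by apply: is_derive_eq (@is_derive1_comp _ f (fun u => a + u) 0 df 1 h' g) _; rewrite mulr1.
Qed.

Lemma lin_derive_left A B z i :
  is_derive z (delta_mx 0 (lshift 1 i)) (lin A B) (A i 0%N (zl z)).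
Proof.
apply: line_is_derive.
rewrite (_ : (fun _ => _) = (fun u => lin A B z + A i 0%N (zl z) * u)); last first.
  apply/funext => u; rewrite /lin /zl !mxE eqxx /= eq_rlshift mulr0 addr0.
  rewrite addrAC; congr (_ + _); rewrite (bigD1 i)//= [in RHS](bigD1 i)//=.
  rewrite !mxE !eqxx /= mulr1 -/(zl z).
  rewrite [X in _ + X = _](_ : _ = \sum_(j < q | j != i) z 0 (lshift 1 j) * A j 0%N (zl z)).
    by ring.
  by apply: eq_bigr => j ji; rewrite !mxE eqxx eq_lshift (negPf ji) /= mulr0 addr0.
rewrite -[X in is_derive _ _ _ X]add0r; apply: is_deriveD.
by rewrite -[X in is_derive _ _ _ X]mulr1; exact: is_deriveZ.
Qed.

Lemma lin_derive_right V A B z : (forall j, tower V (A j)) -> tower V B -> V (zl z) ->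
  is_derive z (delta_mx 0 (rshift q (ord0 : 'I_1))) (lin A B)
    (lin (fun j n => A j n.+1) (fun n => B n.+1) z).
Proof.
move=> hA hB Vz; apply: line_is_derive.
rewrite (_ : (fun _ => _) = (fun u => (\sum_(j < q) (fun u => z 0 (lshift 1 j) *
    A j 0%N (zl z + u))) u + B 0%N (zl z + u))); last first.
  apply/funext => u; rewrite /lin /zl !mxE eqxx /= eqxx mulr1 fct_sumE; congr (_ + _).
  by apply: eq_bigr => j _; rewrite !mxE eq_lrshift /= mulr0 addr0.
rewrite /lin; apply: is_deriveD; last by apply: is_derive_shift0; exact: hB.
apply: is_derive_sum => j; apply: is_deriveZ; apply: is_derive_shift0; exact: hA.
Qed.

Lemma continuous_sum_mul (T : topologicalType) (x : T) (f g : 'I_q -> T -> R) (b : T -> R) :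
  (forall j, {for x, continuous (f j)}) -> (forall j, {for x, continuous (g j)}) ->
  {for x, continuous b} -> {for x, continuous (fun y => \sum_(j < q) f j y * g j y + b y)}.
Proof.
move=> hf hg hb; apply: cvgD; last exact: hb.
elim: (index_enum _) => [|j r IH].
  rewrite big_nil; under eq_cvg do rewrite big_nil.
  exact: cvg_cst.
rewrite big_cons; under eq_cvg do rewrite big_cons.
by apply: cvgD => //; apply: cvgM; [exact: hf|exact: hg].
Qed.

Lemma lin_continuous V A B z : (forall j, tower V (A j)) -> tower V B -> V (zl z) ->
  {for z, continuous (lin A B)}.
Proof.
move=> hA hB Vz.
have co j : {for z, continuous (fun z : 'rV[R]_(q + 1) => z 0 j)}.
  exact: coord_continuous.
have cc (f : R -> R) df : is_derive (zl z) 1 f df -> {for z, continuous (fun z => f (zl z))}.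
  move=> /is_derive_continuous h; apply: (@continuous_comp _ _ _ zl f); first exact: co.
  exact: h.
exact: (@continuous_sum_mul 'rV[R]_(q + 1) z (fun j z => z 0 (lshift 1 j))
  (fun j z => A j 0%N (zl z)) (fun z => B 0%N (zl z)) (fun j => co (lshift 1 j)) (fun j => cc _ _ (hA j 0%N _ Vz))
  (cc _ _ (hB 0%N _ Vz))).
Qed.

Lemma open_cyl V : open V -> open (prodPV (setT : set 'rV[R]_q) V).
Proof.
move=> oV; rewrite (_ : prodPV _ _ = zl @^-1` V).
  by apply: open_comp => // z _; exact: coord_continuous.
by apply/seteqP; split => z; rewrite /prodPV /= mxE //= => -[].
Qed.

Lemma lin_Cn V A B n : open V -> (forall j, tower V (A j)) -> tower V B ->
  Cn n (prodPV setT V) (lin A B).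
Proof.
move=> oV; elim: n A B => [|n IH] A B hA hB /=.
  by move=> z [_ ]; rewrite mxE; exact: lin_continuous.
split; first by move=> z [_ ]; rewrite mxE; exact: lin_continuous.
move=> i; rewrite -[i]fintype.splitK; case: (fintype.split i) => {i}i /=.
  have E z := lin_derive_left A B z i.
  split=> [z _|]; first by case: (E z).
  have T (j : 'I_q) : tower V (fun (_ : nat) (_ : R) => 0 : R).
    by move=> m s _; exact: is_derive_cst.
  apply: (Cn_ext (open_cyl oV) _ (IH (fun _ _ _ => 0) (A i) T (hA i))) => z _.
  have [_ ->] := E z; rewrite /lin big1 ?add0r// => j _; exact: mulr0.
rewrite [i]ord1.
have E z : prodPV setT V z -> is_derive z (delta_mx 0 (rshift q (ord0 : 'I_1))) (lin A B)
    (lin (fun j n => A j n.+1) (fun n => B n.+1) z).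
  by move=> [_]; rewrite mxE; exact: lin_derive_right.
split=> [z /E[]//|].
apply: (Cn_ext (open_cyl oV) _ (IH _ _ (fun j => tower_shift (hA j)) (tower_shift hB))) => z /E[_ ->].
by [].
Qed.

End Linear.

(** * Local representations versus normal forms *)

Section LocalRep.
Variable R : realType.
Implicit Types (F : nat -> R -> R -> R) (x y : FR R).

Lemma rep_Ro x : in_Ro (rep x).
Proof. exact: (proj2_sig x). Qed.

Lemma rep_power_small x : power_small (fun t => rep x t - st x).
Proof. exact: in_Ro_power_small (rep_Ro x). Qed.

Lemma open_nbh (c d : R) : open (nbh c d).
Proof.
rewrite (_ : nbh c d = ball c d); first exact: ball_open.
by apply/seteqP; split => s; rewrite /nbh /ball /= distrC.
Qed.

(** The powers [t ^ e] are themselves Fermat reals; taken as the parameters [p], they make a normal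
    form the extension of a function linear in them. *)
Lemma NF_local_rep (c d : R) F : NF (nbh c d) F -> exists (q : nat) (p : 'I_q -> FR R) al,
  [/\ Cinfty (prodPV (setT : set 'rV[R]_q) (nbh c d)) al,
      forall y t, ext_fun al p y t = F 0%N t (rep y t) &
      forall y t, nbh c d (rep y t) -> ext_fun (partial2 al) p y t = F 1%N t (rep y t)].
Proof.
move=> hF; have [E [D [uE E0 DT FE]]] := NF_collect hF.
have ep (i : 'I_(size E)) : 0 <= E`_i by apply: (all_nthP _ E0).
pose p (i : 'I_(size E)) : FR R := exist _ (fun t => t `^ E`_i) (in_Ro_powR (ep i)).
pose Z (n : nat) (s : R) : R := 0.
have ZT : tower (nbh c d) Z by move=> m s _; exact: is_derive_cst.
exists (size E), p, (lin (fun j : 'I_(size E) => D E`_j) Z).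
have FE' n t s : F n t s = \sum_(j < size E) t `^ E`_j * D E`_j n s.
  by rewrite FE (big_nth 0) big_mkord.
have row y t j : ptv p y t 0 (lshift 1 j) = t `^ E`_j by rewrite row_mxEl mxE.
have last y t : ptv p y t 0 (rshift _ ord0) = rep y t by rewrite row_mxEr mxE.
split.
- by move=> n; apply: lin_Cn => //; exact: open_nbh.
- move=> y t; rewrite /ext_fun /lin last addr0 FE'.
  by apply: eq_bigr => j _; rewrite row.
- move=> y t yd; rewrite /ext_fun /partial2.
  have [|_ ->] := @lin_derive_right _ _ (nbh c d) (fun j : 'I_(size E) => D E`_j) Z (ptv p y t)
    (fun j => DT E`_j) ZT; first by rewrite last.
  by rewrite /lin last addr0 FE'; apply: eq_bigr => j _; rewrite row.
Qed.

Lemma unif_o_in (c d : R) (B : R -> R -> R) y : unif_o (nbh c d) B -> nbh c d (st y) ->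
  is_o (fun t => B t (rep y t)).
Proof.
move=> h /nbh_move[d' d'0 hd']; apply: unif_o_curve d'0 (unif_o_sub hd' h) _; exact: rep_power_small.
Qed.

(** [al] and its last partial derivative are expanded separately and then compared by
    [NF_derive_unique]. That comparison works at the centre, hence the last clause speaks only of
    points with standard part [st x]. *)
Lemma local_rep_NF (S : set (FR R)) (f : FR R -> FR R) x V q P p al :
  @local_rep R S f x V q P p al ->
  exists2 d, 0 < d & exists2 F, NF (nbh (st x) d) F &
   [/\ nbh (st x) d `<=` V,
      forall y, nbh (st x) d (st y) -> is_o (fun t => ext_fun al p y t - F 0%N t (rep y t)) &
      forall y, st y = st x ->
        is_o (fun t => ext_fun (partial2 al) p y t - F 1%N t (rep y t))].
Proof.
move=> [oV [Vx [oP [Pp [hal _]]]]].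
pose w t : 'rV[R]_q := \row_i rep (p i) t.
have wR i : in_Ro (fun t => w t 0 i).
  by have := rep_Ro (p i); congr in_Ro; apply/funext => t; rewrite mxE.
have [d1 d10 [F hF uF]] := @uNF_smooth R q P V (st x) w al oP oV Pp Vx wR hal.
have [d2 d20 [G hG uG]] := @uNF_smooth R q P V (st x) w (partial2 al) oP oV Pp Vx wR
  (Cinfty_derive _ hal).
have [r r0 rU] := open_box oP oV Pp Vx.
pose d := Num.min r (Num.min d1 d2).
have d0 : 0 < d by rewrite !lt_min r0 d10.
have l0 : nbh (st x) d `<=` nbh (st x) r by apply: nbh_le; rewrite ge_min lexx.
have l1 : nbh (st x) d `<=` nbh (st x) d1 by apply: nbh_le; rewrite !ge_min lexx orbT.
have l2 : nbh (st x) d `<=` nbh (st x) d2 by apply: nbh_le; rewrite !ge_min lexx !orbT.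
have wr : near0 (fun t => forall i, `|w t 0 i - w 0 0 i| < r).
  by apply: near0_all => i; apply: power_small_lt r0; exact: in_Ro_power_small (wR i).
exists d => //; exists F; first exact: NF_sub hF.
split.
- move=> s sd; have /rU[_] : box (w 0) (st x) r (mkpt (w 0) s).
    by exists (w 0), s; split => // [i|]; [rewrite subrr normr0|exact: l0].
  by rewrite mkpt_rsub.
- by move=> y yd; exact: (unif_o_in (unif_o_sub l1 uF) yd).
- move=> y yx; apply: (NF_derive_unique d0 (NF_sub l1 hF) (NF_sub l2 hG) _
    (unif_o_sub l1 uF) (unif_o_sub l2 uG)); last by rewrite -yx; exact: rep_power_small.
  apply: near0S wr => t wt s sd.
  have inU : prodPV P V (mkpt (w t) s).
    by apply: rU; exists (w t), s; split => //; exact: l0.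
  have := @is_derive_line _ _ al (mkpt (w t) 0) (delta_mx 0 (rshift q (ord0 : 'I_1))) s.
  rewrite mkpt_right add0r => /(_ (Cinfty_derivable hal inU)).
  by congr is_derive; apply/funext => u; rewrite mkpt_right add0r.
Qed.

End LocalRep.

(** * From local to global along a segment *)

Section Chain.
Variable R : realType.

(** Real induction: the supremum of the points reachable from [s1] is itself reachable and cannot
    lie below [s2]. Gluing is asked for at strictly interior points only, because these are the
    standard points sure to belong to the interval of Fermat reals. *)
Lemma interval_chain (Q : R -> R -> Prop) (s1 s2 : R) : s1 <= s2 ->
  (forall c, s1 <= c <= s2 -> exists2 d, 0 < d & forall x y,
     s1 <= x -> x <= y -> y <= s2 -> nbh c d x -> nbh c d y -> Q x y) ->
  (forall x y z, s1 <= x -> x < y -> y < z -> z <= s2 -> Q x y -> Q y z -> Q x z) ->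
  Q s1 s2.
Proof.
move=> s12 loc trans.
pose A := [set s | s1 <= s <= s2 /\ forall r, s1 <= r <= s -> Q s1 r].
have A1 : A s1.
  split; first by rewrite lexx.
  move=> r /andP[r1 r2]; have -> : r = s1 by apply/le_anti; rewrite r1 r2.
  have [|d d0 H] := loc s1; first by rewrite lexx.
  by apply: H => //; exact: nbh_center.
have hA : has_sup A.
  by split; [exists s1|exists s2 => s [/andP[]]].
set sg := sup A.
have sg1 : s1 <= sg by apply: sup_upper_bound.
have sg2 : sg <= s2 by apply: ge_sup; [exists s1|move=> s [/andP[]]].
have [|d d0 H] := loc sg; first by rewrite sg1.
have [s As] := sup_adherent d0 hA; rewrite -/sg => sgs.
have ss : s <= sg by apply: sup_upper_bound.
have [/andP[ss1 ss2] Qs] := As.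
have K r : s1 <= r -> r <= s2 -> r < sg + d -> Q s1 r.
  move=> r1 r2 r3; case: (leP r s) => rs; first by apply: Qs; rewrite r1.
  have sQ : Q s r.
    have H1 : nbh sg d s by rewrite /nbh /= ltr_norml; apply/andP; split; lra.
    have H2 : nbh sg d r by rewrite /nbh /= ltr_norml; apply/andP; split; lra.
    by apply: H => //; exact: ltW.
  case: (eqVneq s1 s) => [->//|s1s]; apply: trans rs r2 (Qs s _) sQ => //.
    by rewrite lt_neqAle s1s.
  by rewrite ss1 lexx.
suff -> : s2 = sg by apply: K => //; lra.
apply/le_anti; rewrite sg2 andbT leNgt; apply/negP => lt.
(* A reachable point beyond the supremum, still inside the neighbourhood of [sg]. *)
pose m := Num.min s2 (sg + d / 2).
have m1 : m <= s2 by rewrite /m ge_min lexx.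
have m2 : m <= sg + d / 2 by rewrite /m ge_min lexx orbT.
have m3 : sg < m by rewrite /m lt_min lt /=; lra.
suff : A m by move=> /(sup_upper_bound hA); rewrite leNgt m3.
split; first by rewrite m1 andbT; lra.
by move=> r /andP[r1 r2]; apply: K => //; lra.
Qed.

End Chain.

(** * Existence and uniqueness of antiderivatives *)

Section Antiderivatives.
Variable R : realType.
Implicit Types (F : nat -> R -> R -> R) (x y z : FR R) (I : FR R -> FR R).

Definition constF (c : R) : FR R := exist _ (fun=> c) (in_Ro_cst c).

Lemma st_constF c : st (constF c) = c. Proof. by []. Qed.

Definition toFR (w : R -> R) : FR R :=
  match pselect (in_Ro w) with left h => exist _ w h | right _ => constF 0 end.

Lemma rep_toFR w : in_Ro w -> rep (toFR w) = w.
Proof. by rewrite /toFR; case: pselect. Qed.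

(** [S] stands for a non-infinitesimal interval. Convexity yields standard points strictly between
    standard parts only, since points infinitely close to an end may or may not belong to [S]. *)
Variable S : set (FR R).
Hypothesis S_convex : forall x y s, S x -> S y -> st x < s < st y -> S (constF s).
Hypothesis S_wide : exists x y, [/\ S x, S y & st x < st y].

(** [S_wide] keeps the interval nondegenerate even if [st x = st y]; its standard points are those
    where identities are tested. *)
Lemma span x y : S x -> S y -> exists a b, [/\ a < b, a <= st x <= b, a <= st y <= b &
  forall s, a < s < b -> S (constF s)].
Proof.
move=> Sx Sy; have [u [v [Su Sv uv]]] := S_wide.
have mn x1 x2 : S x1 -> S x2 -> exists2 w, S w & (st w <= st x1) /\ (st w <= st x2).
  by move=> S1 S2; case: (leP (st x1) (st x2)) => [?|/ltW ?]; [exists x1|exists x2].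
have mx x1 x2 : S x1 -> S x2 -> exists2 w, S w & (st x1 <= st w) /\ (st x2 <= st w).
  by move=> S1 S2; case: (leP (st x1) (st x2)) => [?|/ltW ?]; [exists x2|exists x1].
have [l1 Sl1 [l11 l12]] := mn _ _ Sx Sy; have [l Sl [l21 l22]] := mn _ _ Sl1 Su.
have [r1 Sr1 [r11 r12]] := mx _ _ Sx Sy; have [r Sr [r21 r22]] := mx _ _ Sr1 Sv.
exists (st l), (st r); split.
- by apply: le_lt_trans l22 _; apply: lt_le_trans uv _.
- by rewrite (le_trans l21 l11) (le_trans r11 r21).
- by rewrite (le_trans l21 l12) (le_trans r12 r21).
- by move=> s; exact: S_convex.
Qed.

(** At the ends [constF c] may lie outside [S], so [x] or [y] itself is returned. *)
Lemma S_between x y c : S x -> S y -> st x <= c <= st y -> exists2 z, S z & st z = c.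
Proof.
move=> Sx Sy; rewrite !le_eqVlt => /andP[/predU1P[<- _|xc]]; first by exists x.
by move=> /predU1P[->|cy]; [exists y|exists (constF c) => //; apply: S_convex Sx Sy _; rewrite xc].
Qed.

Implicit Types h : FR R -> R -> R.

(** Levels 0 and 1 of one normal form represent [I] and [h]. This expresses that [h] is the
    derivative of [I] without reference to a particular local representation. *)
Definition primitive_NF I h (c d : R) F := NF (nbh c d) F /\ forall y, S y -> nbh c d (st y) ->
  is_o (fun t => rep (I y) t - F 0%N t (rep y t)) /\ is_o (fun t => h y t - F 1%N t (rep y t)).

Definition local_primitive I h x := exists2 d, 0 < d & exists F, primitive_NF I h (st x) d F.

Lemma primitive_NF_sub I h c d c' d' F : nbh c' d' `<=` nbh c d ->
  primitive_NF I h c d F -> primitive_NF I h c' d' F.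
Proof. by move=> dd [hF H]; split; [exact: NF_sub hF|move=> y Sy /dd; exact: H]. Qed.

Lemma primitive_NF_local I h c d F x : primitive_NF I h c d F ->
  nbh c d (st x) -> local_primitive I h x.
Proof. by move=> H /nbh_move[d' d'0 hd']; exists d' => //; exists F; exact: primitive_NF_sub H. Qed.

Lemma fsmooth_NF (f : FR R -> FR R) x : fsmooth S f -> S x ->
  exists2 d, 0 < d & exists2 F, NF (nbh (st x) d) F & forall y, S y -> nbh (st x) d (st y) -> is_o (fun t => rep (f y) t - F 0%N t (rep y t)).
Proof.
move=> sf Sx; have [V [q [P [p [al lr]]]]] := sf x Sx.
have [d d0 [F hF [dV EF _]]] := local_rep_NF lr.
exists d => //; exists F => // y Sy yd; have /eqoP fE := lr.2.2.2.2.2 y Sy (dV _ yd).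
by apply: is_o_ext (is_oD fE (EF y yd)) => t _; rewrite subrKA.
Qed.

(** The derivative at [y] is given by a representation around [y], with a normal form [G] unrelated
    to the form [F] around [x]. Both represent [I] at standard points near [st y], so [NF_vanish] at
    level 1 identifies their derivatives along [y]. *)
Lemma antider_local_primitive I h : fsmooth S I -> (forall x, S x -> deriv_is S I x (h x)) ->
  forall x, S x -> local_primitive I h x.
Proof.
move=> sI dI x Sx; have [d d0 [F hF IF]] := fsmooth_NF sI Sx.
exists d => //; exists F; split => // y Sy yd; split; first exact: IF.
have [V' [q' [P' [p' [al' [lr' /eqoP hE]]]]]] := dI y Sy.
have [d1 d10 [G hG [dV' EG EG']]] := local_rep_NF lr'.
have IE' := lr'.2.2.2.2.2.
have [d2 d20 hd2] := nbh_move yd.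
pose e := Num.min d1 d2; have e0 : 0 < e by rewrite lt_min d10.
have e1 : nbh (st y) e `<=` nbh (st y) d1 by apply: nbh_le; rewrite ge_min lexx.
have e2 : nbh (st y) e `<=` nbh (st x) d.
  by apply: subset_trans hd2; apply: nbh_le; rewrite ge_min lexx orbT.
have [a [b [ab ayb _ abS]]] := span Sy Sy.
have o : is_o (fun t => F 1%N t (rep y t) - G 1%N t (rep y t)).
  refine (NF_vanish e0 (NFB (NF_sub e2 hF) (NF_sub e1 hG)) ab ayb _ 1%N (rep_power_small y)).
  move=> s sab sd.
  have Ss := abS s sab.
  have eq1 := IF (constF s) Ss (e2 _ sd).
  have /eqoP eq2 := IE' (constF s) Ss (dV' _ (e1 _ sd)).
  have o3 := EG (constF s) (e1 _ sd).
  by apply: is_o_ext (is_oB (is_oD eq2 o3) eq1) => t _ /=; ring.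
apply: is_o_ext (is_oB (is_oD hE (EG' y erefl)) o) => t _ /=; ring.
Qed.

Lemma local_primitive_antider I h : (forall x, S x -> local_primitive I h x) ->
  fsmooth S I /\ forall x, S x -> deriv_is S I x (h x).
Proof.
move=> H; have K x : S x -> exists V q P p al, @local_rep R S I x V q P p al /\
    eqo (h x) (ext_fun (partial2 al) p x).
  move=> Sx; have [d d0 [F [hF HF]]] := H x Sx.
  have [q [p [al [hal E0 E1]]]] := NF_local_rep hF.
  exists (nbh (st x) d), q, setT, p, al; split.
    split; first exact: open_nbh.
    split; first exact: nbh_center.
    split; first exact: openT.
    do 2 split => //.
    move=> y Sy yd; apply/eqoP; have [eI _] := HF y Sy yd.
    by apply: is_o_ext eI => t _; rewrite E0.
  apply/eqoP; have [_ o] := HF x Sx (nbh_center _ d0).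
  apply: is_o_le o; apply: near0S (power_small_lt (rep_power_small x) d0) => t xd.
  by rewrite E1.
split=> x Sx; have [V [q [P [p [al [lr de]]]]]] := K x Sx.
  by exists V, q, P, p, al.
by exists V, q, P, p, al.
Qed.

(** The difference of the two normal forms has derivative o(t) at standard points, so [NF_const]
    compares its values at both [y] and [z] with that at [st z]. *)
Lemma local_primitive_unique_near I1 I2 h x : S x -> local_primitive I1 h x -> local_primitive I2 h x ->
  exists2 d, 0 < d & forall y z, S y -> S z -> nbh (st x) d (st y) -> nbh (st x) d (st z) ->
    is_o (fun t => (rep (I1 y) t - rep (I2 y) t) - (rep (I1 z) t - rep (I2 z) t)).
Proof.
move=> Sx [d1 d10 [F1 A1]] [d2 d20 [F2 A2]].
have l1 : nbh (st x) (Num.min d1 d2) `<=` nbh (st x) d1 by apply: nbh_le; rewrite ge_min lexx.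
have l2 : nbh (st x) (Num.min d1 d2) `<=` nbh (st x) d2 by apply: nbh_le; rewrite ge_min lexx orbT.
exists (Num.min d1 d2); first by rewrite lt_min d10.
have {A1 l1}[hF1 H1] := primitive_NF_sub l1 A1; have {A2 l2}[hF2 H2] := primitive_NF_sub l2 A2.
move=> y z Sy Sz yd zd; have [a [b [ab ayb azb abS]]] := span Sy Sz.
have F0 s : a < s < b -> nbh (st x) (Num.min d1 d2) s -> is_o (fun t => F1 1%N t s - F2 1%N t s).
  move=> sab sd; have [_ eq1] := H1 _ (abS s sab) sd; have [_ eq2] := H2 _ (abS s sab) sd.
  by apply: is_o_ext (is_oB eq2 eq1) => t _ /=; ring.
have hF := NFB hF1 hF2.
have oy := NF_const hF ab F0 ayb yd azb zd (rep_power_small y).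
have oz := NF_const hF ab F0 azb zd azb zd (rep_power_small z).
have [eq1y _] := H1 y Sy yd; have [eq2y _] := H2 y Sy yd.
have [eq1z _] := H1 z Sz zd; have [eq2z _] := H2 z Sz zd.
apply: is_o_ext (is_oD (is_oB oy oz) (is_oB (is_oB eq1y eq2y) (is_oB eq1z eq2z))) => t _.
by rewrite /=; ring.
Qed.

Definition local_primitive_on I h (s1 s2 : R) :=
  forall x, S x -> s1 <= st x <= s2 -> local_primitive I h x.

Lemma local_primitive_unique I1 I2 h y z : S y -> S z -> st y <= st z ->
  local_primitive_on I1 h (st y) (st z) -> local_primitive_on I2 h (st y) (st z) ->
  is_o (fun t => (rep (I1 y) t - rep (I2 y) t) - (rep (I1 z) t - rep (I2 z) t)).
Proof.
move=> Sy Sz yz G1 G2.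
pose Q s1 s2 := forall u v, S u -> S v -> s1 <= st u <= s2 -> s1 <= st v <= s2 ->
  is_o (fun t => (rep (I1 u) t - rep (I2 u) t) - (rep (I1 v) t - rep (I2 v) t)).
suff : Q (st y) (st z) by apply=> //; rewrite lexx ?yz.
apply: interval_chain => // [c cyz|r1 r2 r3 r1y r12 r23 r3z Q1 Q2].
  have [x Sx xc] := S_between Sy Sz cyz; rewrite -xc in cyz *.
  have [d d0 H] := local_primitive_unique_near Sx (G1 x Sx cyz) (G2 x Sx cyz).
  exists d => // x1 x2 _ _ _ n1 n2 u v Su Sv /andP[u1 u2] /andP[v1 v2].
  move: n1 n2; rewrite /nbh /= !ltr_norml => /andP[? ?] /andP[? ?].
  by apply: H => //; rewrite /nbh /= ltr_norml; apply/andP; split; lra.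
have Sm : S (constF r2) by apply: S_convex Sy Sz _; apply/andP; split; lra.
have K u : S u -> r1 <= st u <= r3 -> is_o (fun t => (rep (I1 u) t - rep (I2 u) t) -
    (rep (I1 (constF r2)) t - rep (I2 (constF r2)) t)).
  move=> Su /andP[u1 u3]; case: (leP (st u) r2) => u2.
    by apply: Q1 => //; rewrite ?u1 ?u2// st_constF lexx ltW.
  by apply: Q2 => //; rewrite ?u3 ?(ltW u2)// st_constF lexx ltW.
move=> u v Su Sv hu hv.
by apply: is_o_ext (is_oB (K u Su hu) (K v Sv hv)) => t _; ring.
Qed.

Lemma local_primitive_congr I I' h x : local_primitive I h x ->
  (exists2 d, 0 < d & forall y, S y -> nbh (st x) d (st y) ->
    is_o (fun t => rep (I' y) t - rep (I y) t)) -> local_primitive I' h x.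
Proof.
move=> [d1 d10 [F A1]] [d2 d20 H].
have l1 : nbh (st x) (Num.min d1 d2) `<=` nbh (st x) d1 by apply: nbh_le; rewrite ge_min lexx.
have l2 : nbh (st x) (Num.min d1 d2) `<=` nbh (st x) d2 by apply: nbh_le; rewrite ge_min lexx orbT.
exists (Num.min d1 d2); first by rewrite lt_min d10.
have [hF HF] := primitive_NF_sub l1 A1; exists F; split => // y Sy yd.
have [eq1 eq2] := HF y Sy yd; split => //.
by apply: is_o_ext (is_oD (H y Sy (l2 _ yd)) eq1) => t _; ring.
Qed.

(** Constants of integration are arbitrary Fermat reals; as normal forms they are constant in
    [s]. *)
Lemma NF_Ro_cst (U : set R) w : in_Ro w -> exists W, [/\ NF U W,
  forall y : R -> R, is_o (fun t => w t - W 0%N t (y t)) & forall n t s, W n.+1 t s = 0].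
Proof.
move=> /in_RoP[l l0 o].
exists (fun n t s => (\sum_(p <- l) p.2 * t `^ p.1) *
  (t `^ 0 * (if n is 0%N then 1 else 0))); split.
- apply: NF_listM l0 _.
  exact: (NF_single (D := fun n _ => if n is 0%N then 1 else 0) (lexx 0) (tower_cst 1)).
- by move=> y; apply: is_o_ext o => t _; rewrite powRr0 !mulr1.
- by move=> n t s; rewrite !mulr0.
Qed.

Lemma local_primitive_add I h x w : in_Ro w -> local_primitive I h x ->
  local_primitive (fun y => toFR (fun t => rep (I y) t + w t)) h x.
Proof.
move=> rw [d d0 [F [hF HF]]]; have [W [hW W0 W1]] := NF_Ro_cst (nbh (st x) d) rw.
exists d => //; exists (fun n t s => F n t s + W n t s); split; first exact: NFD.
move=> y Sy yd; have [eq1 eq2] := HF y Sy yd.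
rewrite rep_toFR; last exact: in_RoD (rep_Ro _) rw.
split; last by apply: is_o_ext eq2 => t _; rewrite W1 addr0.
by apply: is_o_ext (is_oD eq1 (W0 (rep y))) => t _; ring.
Qed.

Definition locNF h x := exists2 d, 0 < d & exists2 F, NF (nbh (st x) d) F &
  forall y, S y -> nbh (st x) d (st y) -> is_o (fun t => h y t - F 0%N t (rep y t)).

Lemma local_antiderivative h x : locNF h x ->
  exists I d, 0 < d /\ forall y, S y -> nbh (st x) d (st y) -> local_primitive I h y.
Proof.
move=> [d d0 [F hF HF]]; have [G hG GF] := NF_primitive d0 hF.
exists (fun y => toFR (fun t => G 0%N t (rep y t))), (d / 2).
split=> [|y Sy yd]; first by rewrite divr_gt0.
apply: (@primitive_NF_local _ _ (st x) (d / 2) G) => //; split=> // z Sz zd.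
have [d' d'0 hd'] := nbh_move zd.
rewrite rep_toFR; last exact: NF_Ro d'0 hd' hG (rep_Ro z).
split; first by apply: is_o_ext (@is_o0 R) => t _; rewrite subrr.
by rewrite GF; apply: HF => //; apply: nbh_le zd; lra.
Qed.

Lemma antiderivative_on h y z : (forall x, S x -> locNF h x) -> S y -> S z ->
  st y <= st z -> exists I, local_primitive_on I h (st y) (st z).
Proof.
move=> H Sy Sz yz; apply: (@interval_chain _ (fun s1 s2 => exists I, local_primitive_on I h s1 s2)) => //.
  move=> c cyz; have [x Sx <-] := S_between Sy Sz cyz.
  have [I [d [d0 G]]] := local_antiderivative (H x Sx); exists d => // r1 r2 _ _ _ n1 n2.
  exists I => u Su /andP[u1 u2]; apply: G => //.
  move: n1 n2; rewrite /nbh /= !ltr_norml => /andP[? ?] /andP[? ?].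
  by apply/andP; split; lra.
move=> r1 r2 r3 r1y r12 r23 r3z [I1 G1] [I2 G2].
have Sm : S (constF r2) by apply: S_convex Sy Sz _; apply/andP; split; lra.
set m := constF r2 in Sm; have rm : st m = r2 by [].
pose w t := rep (I1 m) t - rep (I2 m) t.
have rw : in_Ro w by apply: in_RoB; exact: rep_Ro.
pose I3 u := toFR (fun t => rep (I2 u) t + w t).
(* The cut is by standard part, so all points infinitely close to [r2] fall into the right piece.
   Around them the two pieces agree up to o(t), by local uniqueness and the shift [w]. *)
exists (fun u => if st u < r2 then I1 u else I3 u) => u Su /andP[u1 u3].
have oI v : is_o (fun t => rep (I3 v) t - rep (I2 v) t - w t).
  rewrite rep_toFR; last exact: in_RoD (rep_Ro _) rw.
  by apply: is_o_ext (@is_o0 R) => t _; ring.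
case: (ltgtP (st u) r2) => ur.
- apply: (local_primitive_congr (G1 u Su _)); first by rewrite u1 ltW.
  exists (r2 - st u); first by rewrite subr_gt0.
  move=> v Sv; rewrite /nbh /= ltr_norml => /andP[v1 v2].
  by rewrite ifT; [apply: is_o_ext (@is_o0 R) => t _; rewrite subrr|lra].
- apply: (local_primitive_congr (local_primitive_add rw (G2 u Su _))); first by rewrite u3 ltW.
  exists (st u - r2); first by rewrite subr_gt0.
  move=> v Sv; rewrite /nbh /= ltr_norml => /andP[v1 v2].
  rewrite ifF; first by apply: is_o_ext (@is_o0 R) => t _; rewrite subrr.
  by apply/negbTE; rewrite -leNgt; lra.
- have g1 : local_primitive I1 h u by apply: G1 => //; rewrite ur; apply/andP; split; lra.
  have g2 : local_primitive I2 h u by apply: G2 => //; rewrite ur; apply/andP; split; lra.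
  apply: (local_primitive_congr g1); have [d d0 Hd] := local_primitive_unique_near Su g1 g2.
  exists d => // v Sv vd; case: ifP => _.
    by apply: is_o_ext (@is_o0 R) => t _; rewrite subrr.
  have um : nbh (st u) d (st m) by rewrite rm -ur; exact: nbh_center.
  apply: is_o_ext (is_oB (oI v) (Hd v m Sv Sm vd um)) => t _.
  by rewrite /w; ring.
Qed.

(** [S] may be unbounded or lack its ends, so every [y] receives its own primitive [J y] on the
    segment between [u] and [y]. Near a given [x] all of these agree, up to constants, with one
    primitive [K] on a segment that contains [u] and all points of [S] near [x]. *)
Lemma antiderivative h u : (forall x, S x -> locNF h x) -> S u ->
  exists2 I, (forall x, S x -> local_primitive I h x) & is_o (rep (I u)).
Proof.
move=> H Su.
have ex y : exists I, S y -> local_primitive_on I h (Num.min (st u) (st y)) (Num.max (st u) (st y)).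
  case: (pselect (S y)) => Sy; last by exists id.
  case: (leP (st u) (st y)) => [uy|/ltW uy].
    by have [I G] := antiderivative_on H Su Sy uy; exists I.
  by have [I G] := antiderivative_on H Sy Su uy; exists I.
have [J HJ] := boolp.choice ex.
pose I y := toFR (fun t => rep (J y y) t - rep (J y u) t).
have IE y : rep (I y) = (fun t => rep (J y y) t - rep (J y u) t).
  by rewrite rep_toFR//; apply: in_RoB; exact: rep_Ro.
exists I; last by rewrite IE; apply: is_o_ext (@is_o0 R) => t _; rewrite subrr.
move=> x Sx.
(* A point of [S] to the left of [x] leaves room for a neighbourhood; if there is none, [st x] is
   minimal and [x] itself is the left end. *)
have [l [Sl lu [dl dl0 lx]]] : exists l, [/\ S l, st l <= st u &
    exists2 d, 0 < d & forall y, S y -> nbh (st x) d (st y) -> st l <= st y].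
  case: (pselect (exists2 w, S w & st w < st x)) => [[w Sw wx]|nw].
    case: (leP (st w) (st u)) => wu.
      exists w; split => //; exists (st x - st w); first by rewrite subr_gt0.
      by move=> y Sy; rewrite /nbh /= ltr_norml => /andP[? ?]; lra.
    exists u; split => //; exists (st x - st w); first by rewrite subr_gt0.
    by move=> y Sy; rewrite /nbh /= ltr_norml => /andP[? ?]; lra.
  exists x; split => //.
    by rewrite leNgt; apply/negP => ux; apply: nw; exists u.
  exists 1 => // y Sy _; rewrite leNgt; apply/negP => yx; by apply: nw; exists y.
have [r [Sr ur [dr dr0 rx]]] : exists r, [/\ S r, st u <= st r &
    exists2 d, 0 < d & forall y, S y -> nbh (st x) d (st y) -> st y <= st r].
  case: (pselect (exists2 w, S w & st x < st w)) => [[w Sw wx]|nw].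
    case: (leP (st u) (st w)) => wu.
      exists w; split => //; exists (st w - st x); first by rewrite subr_gt0.
      by move=> y Sy; rewrite /nbh /= ltr_norml => /andP[? ?]; lra.
    exists u; split => //; exists (st w - st x); first by rewrite subr_gt0.
    by move=> y Sy; rewrite /nbh /= ltr_norml => /andP[? ?]; lra.
  exists x; split => //.
    by rewrite leNgt; apply/negP => ux; apply: nw; exists u.
  exists 1 => // y Sy _; rewrite leNgt; apply/negP => yx; by apply: nw; exists y.
have [K GK] := antiderivative_on H Sl Sr (le_trans lu ur).
have rKu : in_Ro (fun t => - rep (K u) t).
  by have := in_RoZ (-1) (rep_Ro (K u)); congr in_Ro; apply/funext => t; rewrite mulN1r.
have gx : local_primitive K h x.
  by apply: GK => //; rewrite (lx x Sx (nbh_center _ dl0)) (rx x Sx (nbh_center _ dr0)).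
apply: (local_primitive_congr (local_primitive_add rKu gx)).
exists (Num.min dl dr); first by rewrite lt_min dl0.
move=> y Sy yd.
have ly : st l <= st y by apply: lx => //; apply: nbh_le yd; rewrite ge_min lexx.
have ry : st y <= st r by apply: rx => //; apply: nbh_le yd; rewrite ge_min lexx orbT.
rewrite IE rep_toFR; last exact: in_RoD (rep_Ro _) rKu.
have := HJ y Sy; case: (leP (st u) (st y)) => [uy|/ltW uy] GJ.
  have GK' : local_primitive_on K h (st u) (st y).
    move=> v Sv /andP[v1 v2]; apply: GK => //.
    by rewrite (le_trans lu v1) (le_trans v2 ry).
  by apply: is_o_ext (is_oN (local_primitive_unique Su Sy uy GJ GK')) => t _; ring.
have GK' : local_primitive_on K h (st y) (st u).
  move=> v Sv /andP[v1 v2]; apply: GK => //.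
  by rewrite (le_trans ly v1) (le_trans v2 ur).
by apply: is_o_ext (local_primitive_unique Sy Su uy GJ GK') => t _; ring.
Qed.

End Antiderivatives.

(** * The Cauchy-Schwarz inequality *)

Section RealCauchySchwarz.
Variable R : realType.

Lemma ler_of_sqr (a b : R) : 0 <= b -> a ^+ 2 <= b ^+ 2 -> a <= b.
Proof.
move=> b0 ab; apply: le_trans (ler_norm a) _.
by rewrite -(ler_pXn2r (n := 2))// ?nnegrE// real_normK// num_real.
Qed.

(** The cross term is bounded by squaring: [4 x1^2 x2^2 <= 4 (y1 z2) (y2 z1) <= (y1 z2 + y2
    z1)^2]. *)
Lemma cauchy_add (x1 y1 z1 x2 y2 z2 : R) : 0 <= y1 -> 0 <= z1 -> 0 <= y2 -> 0 <= z2 ->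
  x1 ^+ 2 <= y1 * z1 -> x2 ^+ 2 <= y2 * z2 ->
  (x1 + x2) ^+ 2 <= (y1 + y2) * (z1 + z2).
Proof.
move=> y10 z10 y20 z20 h1 h2.
have h : 2 * (x1 * x2) <= y1 * z2 + y2 * z1.
  apply: ler_of_sqr; first by rewrite addr_ge0 ?mulr_ge0.
  have h3 : x1 ^+ 2 * x2 ^+ 2 <= (y1 * z1) * (y2 * z2) by rewrite ler_pM ?sqr_ge0.
  have := sqr_ge0 (y1 * z2 - y2 * z1); rewrite !expr2 in h3 *; lra.
rewrite !expr2 in h1 h2 *; lra.
Qed.

(** Discriminant argument on increments: the quadratic form in [l] is the increment of a function
    with derivative [(l f + g)^2], hence is nonnegative. *)
Lemma cauchy_derive (f g m1 m2 m3 : R -> R) (a b : R) : a <= b ->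
  (forall s, a <= s <= b -> is_derive s 1 m1 (f s * g s)) ->
  (forall s, a <= s <= b -> is_derive s 1 m2 (f s * f s)) ->
  (forall s, a <= s <= b -> is_derive s 1 m3 (g s * g s)) ->
  [/\ 0 <= m2 b - m2 a, 0 <= m3 b - m3 a &
      (m1 b - m1 a) ^+ 2 <= (m2 b - m2 a) * (m3 b - m3 a)].
Proof.
move=> ab h1 h2 h3; have ba : 0 <= b - a by rewrite subr_ge0.
have Y0 : 0 <= m2 b - m2 a.
  by have [s _ ->] := mvt ab h2; rewrite mulr_ge0// -expr2 sqr_ge0.
have Z0 : 0 <= m3 b - m3 a.
  by have [s _ ->] := mvt ab h3; rewrite mulr_ge0// -expr2 sqr_ge0.
have quad (l : R) : 0 <= l ^+ 2 * (m2 b - m2 a) + 2 * l * (m1 b - m1 a) + (m3 b - m3 a).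
  have [|s _ E] := @mvt _ (fun s => l ^+ 2 * m2 s + 2 * l * m1 s + m3 s)
    (fun s => (l * f s + g s) ^+ 2) a b ab.
    move=> s sab; apply: is_derive_eq (is_deriveD (is_deriveD
      (is_deriveZ (l ^+ 2) (h2 s sab)) (is_deriveZ (2 * l) (h1 s sab))) (h3 s sab)) _.
    by rewrite /GRing.scale/=; ring.
  rewrite (_ : _ + _ = (l * f s + g s) ^+ 2 * (b - a)); first by rewrite mulr_ge0// sqr_ge0.
  by rewrite -E; ring.
split => //; move: quad Y0 Z0.
move: (m2 b - _) (m3 b - _) (m1 b - _) => Y Z X quad Y0 Z0.
move: Y0; rewrite le_eqVlt => /predU1P[Y0|Y0].
  rewrite -Y0 mul0r; have [->|X0] := eqVneq X 0; first by rewrite expr0n.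
  (* If [Y = 0] and [X] is nonzero, the form is affine in [l] and takes the value -1 here. *)
  have := quad (- (Z + 1) / (2 * X)); rewrite -Y0 mulr0 add0r.
  have -> : 2 * (- (Z + 1) / (2 * X)) * X = - (Z + 1) by field.
  lra.
(* The minimizer of the form. *)
have := quad (- X / Y).
have -> : (- X / Y) ^+ 2 * Y + 2 * (- X / Y) * X + Z = Z - X ^+ 2 / Y by field; rewrite gt_eqF.
by rewrite subr_ge0 ler_pdivrMr// mulrC.
Qed.

End RealCauchySchwarz.

(** * Cauchy-Schwarz for increments of antiderivatives *)

Section FermatCauchySchwarz.
Variable R : realType.
Implicit Types (F : nat -> R -> R -> R) (x y z : FR R) (I : FR R -> FR R).

Lemma NF_is_o_congr (U : set R) (d : R) F n (y z : R -> R) : 0 < d -> nbh (y 0) d `<=` U ->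
  NF U F -> power_small (fun t => y t - y 0) -> is_o (fun t => z t - y t) ->
  is_o (fun t => F n t (z t) - F n t (y t)).
Proof.
move=> d0 dU hF yp zy; have [d' d'0 [M HM]] := NF_bounded n.+1 d0 dU hF.
(* Halved because [y t - y 0] and [z t - y t] are each kept below [e], which holds the segment
   between [y t] and [z t] within [2 * e] of [y 0]. *)
pose e := Num.min d d' / 2.
have e0 : 0 < e by rewrite divr_gt0// lt_min d0.
have ed : 2 * e <= d by rewrite /e mulrC divfK// ge_min lexx.
have ed' : 2 * e <= d' by rewrite /e mulrC divfK// ge_min lexx orbT.
have := is_oM (bounded_cst M) zy; apply: is_o_le.
apply: near0S3 HM (power_small_lt yp e0) (power_small_lt (is_o_power_small zy) e0) => t HM ye ze.
rewrite normrM; apply: (@le_trans _ _ (M * `|z t - y t|)); last first.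
  by rewrite ler_wpM2r ?ler_norm.
have N s : `|s - y t| <= `|z t - y t| -> `|s - y 0| < 2 * e.
  move=> h; have := ler_normD (s - y t) (y t - y 0); rewrite subrKA; lra.
apply: (@mvt_le _ _ (F n.+1 t)) => s /N h.
- by apply: (NF_derive hF n t); apply: dU; exact: lt_le_trans ed.
- by apply: HM; exact: lt_le_trans ed'.
Qed.

Lemma leF_st x y : leF (rep x) (rep y) -> st x <= st y.
Proof.
move=> [w [_ [/eqoP ow [d [d0 H]]]]]; have := H 0 (lexx _) d0.
have := power_small0 (is_o_power_small ow); rewrite /= subr0 => ->; by rewrite addr0.
Qed.

Lemma leF_lt (v w : R -> R) : in_Ro v -> in_Ro w -> v 0 < w 0 -> leF v w.
Proof.
move=> rv rw vw; exists (fun=> 0); split; first exact: in_Ro_cst.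
split; first by apply/eqoP; apply: is_o_ext (@is_o0 R) => t _; rewrite subrr.
have d0 : 0 < (w 0 - v 0) / 2 by lra.
have [d dp Hd] := near0S2 (fun t h k => conj h k) (power_small_lt (in_Ro_power_small rv) d0)
  (power_small_lt (in_Ro_power_small rw) d0).
exists d; split => // t t0 td; have [] := Hd t; first by rewrite t0.
by rewrite !ltr_norml => /andP[? ?] /andP[? ?]; lra.
Qed.

Lemma ltF_st x y : st x < st y -> ltF (rep x) (rep y).
Proof.
move=> xy; split; first exact: leF_lt (rep_Ro x) (rep_Ro y) xy.
move=> /eqoP /is_o_power_small /power_small0 /eqP; rewrite subr_eq0 => /eqP E.
by move: xy; rewrite /st E ltxx.
Qed.

Variable S : set (FR R).
Hypothesis S_convex : forall x y s, S x -> S y -> st x < s < st y -> S (constF s).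
Hypothesis S_wide : exists x y, [/\ S x, S y & st x < st y].

Lemma fsmooth_NF2 f g x : fsmooth S f -> fsmooth S g -> S x ->
  exists2 d, 0 < d & exists F G, [/\ NF (nbh (st x) d) F, NF (nbh (st x) d) G &
  forall y, S y -> nbh (st x) d (st y) -> is_o (fun t => rep (f y) t - F 0%N t (rep y t)) /\
    is_o (fun t => rep (g y) t - G 0%N t (rep y t))].
Proof.
move=> sf sg Sx; have [d1 d10 [F hF FE]] := fsmooth_NF sf Sx.
have [d2 d20 [G hG GE]] := fsmooth_NF sg Sx.
have l1 : nbh (st x) (Num.min d1 d2) `<=` nbh (st x) d1 by apply: nbh_le; rewrite ge_min lexx.
have l2 : nbh (st x) (Num.min d1 d2) `<=` nbh (st x) d2 by apply: nbh_le; rewrite ge_min lexx orbT.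
exists (Num.min d1 d2); first by rewrite lt_min d10.
exists F, G; split; [exact: NF_sub hF|exact: NF_sub hG|].
by move=> y Sy yd; split; [apply: FE (l1 _ yd)|apply: GE (l2 _ yd)].
Qed.

Definition prod_curve (f g : FR R -> FR R) y t := rep (f y) t * rep (g y) t.

Lemma is_o_mul_congr (v w v' w' : R -> R) : bounded_curve v' -> bounded_curve w ->
  is_o (fun t => v t - v' t) -> is_o (fun t => w t - w' t) ->
  is_o (fun t => v t * w t - v' t * w' t).
Proof. by move=> bv bw ov ow; apply: is_o_ext (is_oD (is_oM bw ov) (is_oM bv ow)) => t _; ring. Qed.

Lemma prod_NF f g x d F G H : NF (nbh (st x) d) F -> NF (nbh (st x) d) G ->
  (forall t s, H 0%N t s = F 0%N t s * G 0%N t s) ->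
  (forall y, S y -> nbh (st x) d (st y) -> is_o (fun t => rep (f y) t - F 0%N t (rep y t)) /\
    is_o (fun t => rep (g y) t - G 0%N t (rep y t))) ->
  forall y, S y -> nbh (st x) d (st y) -> is_o (fun t => prod_curve f g y t - H 0%N t (rep y t)).
Proof.
move=> hF hG HE FG y Sy yd; have [fF gG] := FG y Sy yd.
have [d' d'0 hd'] := nbh_move yd.
have bF := NF_curve_bounded 0%N d'0 hd' hF (rep_power_small y).
apply: is_o_ext (is_o_mul_congr bF (in_Ro_bounded (rep_Ro (g y))) fF gG) => t _.
by rewrite HE.
Qed.

Lemma prod_locNF f g x : fsmooth S f -> fsmooth S g -> S x -> locNF S (prod_curve f g) x.
Proof.
move=> sf sg Sx; have [d d0 [F [G [hF hG FG]]]] := fsmooth_NF2 sf sg Sx.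
have [H hH HE] := NFM hF hG; exists d => //; exists H => //; exact: prod_NF HE FG.
Qed.

Section Relation.
Variables (f g I1 I2 I3 : FR R -> FR R).

(* The inequality is exact for representatives [X], [Y], [Z] of the increments, with no [o(t)] error:
   this makes the relation transitive. *)
Definition cs_rel y z := exists X Y Z : R -> R,
  [/\ near0 (fun t => [/\ 0 <= Y t, 0 <= Z t & X t ^+ 2 <= Y t * Z t]),
      is_o (fun t => rep (I1 z) t - rep (I1 y) t - X t),
      is_o (fun t => rep (I2 z) t - rep (I2 y) t - Y t) &
      is_o (fun t => rep (I3 z) t - rep (I3 y) t - Z t)].

Lemma cs_rel_trans x y z : cs_rel x y -> cs_rel y z -> cs_rel x z.
Proof.
move=> [X [Y [Z [e1 a1 b1 c1]]]] [X' [Y' [Z' [e2 a2 b2 c2]]]].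
exists (fun t => X t + X' t), (fun t => Y t + Y' t), (fun t => Z t + Z' t); split.
- apply: near0S2 e1 e2 => t [y0 z0 h] [y0' z0' h'].
  by split; [exact: addr_ge0|exact: addr_ge0|exact: cauchy_add].
- by apply: is_o_ext (is_oD a1 a2) => t _; ring.
- by apply: is_o_ext (is_oD b1 b2) => t _; ring.
- by apply: is_o_ext (is_oD c1 c2) => t _; ring.
Qed.

Hypotheses (sf : fsmooth S f) (sg : fsmooth S g).
Hypotheses (G1 : forall x, S x -> local_primitive S I1 (prod_curve f g) x)
  (G2 : forall x, S x -> local_primitive S I2 (prod_curve f f) x)
  (G3 : forall x, S x -> local_primitive S I3 (prod_curve g g) x).

(** A form of [I] has derivative [F * G] only up to o(t), whereas the real inequality needs it
    exactly for every [t]. So [I] is compared with the antiderivative [K] built from an exact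
    primitive [M] of [H]; their increments agree up to o(t). *)
Lemma increment_NF u v I x d F G H : 0 < d -> NF (nbh (st x) d) F -> NF (nbh (st x) d) G ->
  NF (nbh (st x) d) H -> (forall t s, H 0%N t s = F 0%N t s * G 0%N t s) ->
  (forall y, S y -> nbh (st x) d (st y) -> is_o (fun t => rep (u y) t - F 0%N t (rep y t)) /\
    is_o (fun t => rep (v y) t - G 0%N t (rep y t))) ->
  (forall x, S x -> local_primitive S I (prod_curve u v) x) -> S x ->
  exists2 e, 0 < e <= d & exists2 M, NF (nbh (st x) e) M &
    (forall n, M n.+1 = H n) /\
    forall y z, S y -> S z -> nbh (st x) e (st y) -> nbh (st x) e (st z) ->
      is_o (fun t => rep (I z) t - rep (I y) t - (M 0%N t (rep z t) - M 0%N t (rep y t))).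
Proof.
move=> d0 hF hG hH HE FG GI Sx; have [M hM MH] := NF_primitive d0 hH.
pose K y := toFR (fun t => M 0%N t (rep y t)).
have d2 : 0 < d / 2 by rewrite divr_gt0.
have KE y : nbh (st x) (d / 2) (st y) -> rep (K y) = (fun t => M 0%N t (rep y t)).
  by move=> /nbh_move[d' d'0 hd']; rewrite rep_toFR//; exact: NF_Ro d'0 hd' hM (rep_Ro y).
have gK : local_primitive S K (prod_curve u v) x.
  exists (d / 2) => //; exists M; split => // y Sy yd; rewrite KE//; split.
    by apply: is_o_ext (@is_o0 R) => t _; rewrite subrr.
  by rewrite MH; apply: (prod_NF hF hG HE FG) => //; apply: nbh_le yd; lra.
have [e e0 He] := local_primitive_unique_near S_convex S_wide Sx (GI x Sx) gK.
have l1 : nbh (st x) (Num.min e (d / 2)) `<=` nbh (st x) e by apply: nbh_le; rewrite ge_min lexx.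
have l2 : nbh (st x) (Num.min e (d / 2)) `<=` nbh (st x) (d / 2).
  by apply: nbh_le; rewrite ge_min lexx orbT.
exists (Num.min e (d / 2)).
  by rewrite lt_min e0 d2 /= ge_min; apply/orP; right; lra.
exists M; first exact: NF_sub hM.
split=> // y z Sy Sz yd zd; have := He z y Sz Sy (l1 _ zd) (l1 _ yd).
rewrite !KE; [|exact: l2..].
by move=> h; apply: is_o_ext h => t _; ring.
Qed.

Lemma cs_rel_local x : S x -> exists2 d, 0 < d & forall y z, S y -> S z ->
  nbh (st x) d (st y) -> nbh (st x) d (st z) -> leF (rep y) (rep z) -> cs_rel y z.
Proof.
move=> Sx; have [d d0 [F [G [hF hG FG]]]] := fsmooth_NF2 sf sg Sx.
have [H1 hH1 HE1] := NFM hF hG.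
have [H2 hH2 HE2] := NFM hF hF.
have [H3 hH3 HE3] := NFM hG hG.
have FF y : S y -> nbh (st x) d (st y) -> is_o (fun t => rep (f y) t - F 0%N t (rep y t)) /\
    is_o (fun t => rep (f y) t - F 0%N t (rep y t)).
  by move=> Sy yd; have [] := FG y Sy yd.
have GG y : S y -> nbh (st x) d (st y) -> is_o (fun t => rep (g y) t - G 0%N t (rep y t)) /\
    is_o (fun t => rep (g y) t - G 0%N t (rep y t)).
  by move=> Sy yd; have [] := FG y Sy yd.
have [e1 /andP[e10 e1d] [M1 hM1 [MH1 D1]]] := increment_NF d0 hF hG hH1 HE1 FG G1 Sx.
have [e2 /andP[e20 e2d] [M2 hM2 [MH2 D2]]] := increment_NF d0 hF hF hH2 HE2 FF G2 Sx.
have [e3 /andP[e30 e3d] [M3 hM3 [MH3 D3]]] := increment_NF d0 hG hG hH3 HE3 GG G3 Sx.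
pose e := Num.min e1 (Num.min e2 e3).
have e0 : 0 < e by rewrite !lt_min e10 e20.
have l1 : nbh (st x) e `<=` nbh (st x) e1 by apply: nbh_le; rewrite !ge_min lexx.
have l2 : nbh (st x) e `<=` nbh (st x) e2 by apply: nbh_le; rewrite !ge_min lexx orbT.
have l3 : nbh (st x) e `<=` nbh (st x) e3 by apply: nbh_le; rewrite !ge_min lexx !orbT.
exists e => // y z Sy Sz ye ze [w [_ [/eqoP ow [dw [dw0 yzw]]]]].
(* [leF] orders the representatives only up to o(t); the maximum orders them exactly and differs
   from [rep z] by at most that error. *)
pose z' t := Num.max (rep y t) (rep z t).
have oz : is_o (fun t => z' t - rep z t).
  apply: is_o_le ow; exists dw => // t /andP[t0 tw]; rewrite subr0.
  have w1 := yzw t t0 tw; have w2 := ler_norm (w t); rewrite /z'.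
  case: (leP (rep y t) (rep z t)) => h; first by rewrite subrr normr0.
  by rewrite gtr0_norm ?subr_gt0//; lra.
have z'z : z' 0 = st z.
  by have := power_small0 (is_o_power_small oz) => /eqP; rewrite subr_eq0 => /eqP.
have [dy dy0 hdy] := nbh_move ye; have [dz dz0 hdz] := nbh_move ze.
have C M : NF (nbh (st x) e) M -> is_o (fun t => M 0%N t (z' t) - M 0%N t (rep z t)).
  by move=> hM; exact: NF_is_o_congr dz0 hdz hM (rep_power_small z) oz.
exists (fun t => M1 0%N t (z' t) - M1 0%N t (rep y t)),
  (fun t => M2 0%N t (z' t) - M2 0%N t (rep y t)),
  (fun t => M3 0%N t (z' t) - M3 0%N t (rep y t)); split; first last.
- apply: is_o_ext (is_oB (D3 y z Sy Sz (l3 _ ye) (l3 _ ze)) (C M3 (NF_sub l3 hM3))) => t _.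
  by ring.
- apply: is_o_ext (is_oB (D2 y z Sy Sz (l2 _ ye) (l2 _ ze)) (C M2 (NF_sub l2 hM2))) => t _.
  by ring.
- apply: is_o_ext (is_oB (D1 y z Sy Sz (l1 _ ye) (l1 _ ze)) (C M1 (NF_sub l1 hM1))) => t _.
  by ring.
have zp : power_small (fun t => z' t - st z).
  have := power_smallD (is_o_power_small oz) (rep_power_small z); congr power_small; apply/funext => t.
  by rewrite subrKA.
apply: near0S2 (power_small_lt (rep_power_small y) dy0) (power_small_lt zp dz0) => t yt zt.
have yz : rep y t <= z' t by rewrite /z' le_max lexx.
have inE s : rep y t <= s <= z' t -> nbh (st x) e s.
  move=> /andP[s1 s2]; have := hdy _ yt; have := hdz _ zt.
  rewrite /nbh /= !ltr_norml => /andP[? ?] /andP[? ?]; apply/andP; split; lra.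
(* With [t] fixed this is the classical inequality on the real segment from [rep y t] to [z' t]. *)
apply: (@cauchy_derive _ (F 0%N t) (G 0%N t)
  (M1 0%N t) (M2 0%N t) (M3 0%N t)) => // s /inE se.
- by rewrite -HE1 -MH1; exact: (NF_derive hM1 0%N t (l1 _ se)).
- by rewrite -HE2 -MH2; exact: (NF_derive hM2 0%N t (l2 _ se)).
- by rewrite -HE3 -MH3; exact: (NF_derive hM3 0%N t (l3 _ se)).
Qed.

(** Infinitely close points cannot be separated by a standard point, so [Q] ranges over all
    [leF]-ordered pairs; a cut at [constF r2] is made only when [st u < r2 < st v]. *)
Lemma cs_rel_le a b : S a -> S b -> leF (rep a) (rep b) -> cs_rel a b.
Proof.
move=> Sa Sb ab; have sab := leF_st ab.
pose Q s1 s2 := forall u v, S u -> S v -> s1 <= st u -> st v <= s2 ->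
  leF (rep u) (rep v) -> cs_rel u v.
suff : Q (st a) (st b) by apply.
apply: interval_chain => // [c cab|r1 r2 r3 r1y r12 r23 r3z Q1 Q2].
  have [x Sx xc] := S_between S_convex Sa Sb cab; rewrite -xc.
  have [d d0 H] := cs_rel_local Sx.
  exists d => // x1 x2 _ _ _ n1 n2 u v Su Sv u1 v2 uv.
  have uv' := leF_st uv; move: n1 n2; rewrite /nbh /= !ltr_norml => /andP[? ?] /andP[? ?].
  by apply: H => //; rewrite /nbh /= ltr_norml; apply/andP; split; lra.
move=> u v Su Sv u1 v3 uv.
case: (leP (st v) r2) => v2; first exact: Q1.
case: (leP r2 (st u)) => u2; first exact: Q2.
have Sm : S (constF r2) by apply: S_convex Sa Sb _; apply/andP; split; lra.
apply: (@cs_rel_trans _ (constF r2)).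
  by apply: Q1 => //; apply: leF_lt; [exact: rep_Ro|exact: rep_Ro|].
by apply: Q2 => //; apply: leF_lt; [exact: rep_Ro|exact: rep_Ro|].
Qed.

End Relation.

End FermatCauchySchwarz.

(** * Non-infinitesimal intervals *)

Section Intervals.
Variables (R : realType) (J : fitv R).

(** A strict inequality of standard parts gives both [leF] and [ltF], so the kind of bracket does
    not matter. *)
Lemma in_fitv_between (x y z : FR R) : in_fitv J x -> in_fitv J y -> st x < st z < st y ->
  in_fitv J z.
Proof.
move=> [xl _] [_ yr] /andP[xz zy]; split.
  case: (lo J) xl => // a; case: (lo_closed J) => [/leF_st ax|[/leF_st ax _]].
    by have [] := ltF_st (le_lt_trans ax xz).
  exact: ltF_st (le_lt_trans ax xz).
case: (hi J) yr => // b; case: (hi_closed J) => [/leF_st yb|[/leF_st yb _]].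
  by have [] := ltF_st (lt_le_trans zy yb).
exact: ltF_st (lt_le_trans zy yb).
Qed.

Lemma noninf_in (z : FR R) : (xst (lo J) < (st z)%:E)%E -> ((st z)%:E < xst (hi J))%E ->
  in_fitv J z.
Proof.
move=> lz zh; split.
  case: (lo J) lz => //= a; rewrite lte_fin => az.
  by case: (lo_closed J); [have [] := ltF_st az|exact: ltF_st].
case: (hi J) zh => //= b; rewrite lte_fin => zb.
by case: (hi_closed J); [have [] := ltF_st zb|exact: ltF_st].
Qed.

Lemma noninf_wide : noninf J -> exists x y, [/\ in_fitv J x, in_fitv J y & st x < st y].
Proof.
move=> [_ lh].
suff [u [v [uv lu vh]]] : exists u v : R, [/\ u < v, (xst (lo J) < u%:E)%E & (v%:E < xst (hi J))%E].
  exists (constF u), (constF v); split => //; apply: noninf_in => //=.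
    by apply: lt_trans vh; rewrite lte_fin.
  by apply: lt_trans lu _; rewrite lte_fin.
move: lh; case: (xst (lo J)) => [l||]; case: (xst (hi J)) => [h||] //=.
- rewrite lte_fin => lh; exists ((2 * l + h) / 3), ((l + 2 * h) / 3).
  by rewrite !lte_fin; split; lra.
- by move=> _; exists (l + 1), (l + 2); rewrite lte_fin ltry; split => //; lra.
- by move=> _; exists (h - 2), (h - 1); rewrite lte_fin ltNyr; split => //; lra.
- by move=> _; exists 0, 1; rewrite ltry ltNyr ltr01.
Qed.

End Intervals.

Theorem theorem31 (R : realType) (J : fitv R) (f g : FR R -> FR R) (a b : FR R) :
  noninf J -> fsmooth (in_fitv J) f -> fsmooth (in_fitv J) g ->
  in_fitv J a -> in_fitv J b -> ltF (rep a) (rep b) ->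
  leF (fun t => (fintegral J (fun x s => rep (f x) s * rep (g x) s) a b t) ^+ 2)
      (fun t => fintegral J (fun x s => rep (f x) s ^+ 2) a b t *
                fintegral J (fun x s => rep (g x) s ^+ 2) a b t).
Proof.
move=> nJ sf sg Ja Jb [ab _].
have cvx x y s : in_fitv J x -> in_fitv J y -> st x < s < st y -> in_fitv J (constF s).
  by move=> Jx Jy xsy; exact: (in_fitv_between Jx Jy).
have wide := noninf_wide nJ.
(* The integral is an epsilon choice, so existence has to come first. The chosen antiderivative [I]
   need not be the constructed [K]; only its defining properties are kept. *)
have spec u v : fsmooth (in_fitv J) u -> fsmooth (in_fitv J) v ->
    exists I, [/\ forall x, in_fitv J x -> local_primitive (in_fitv J) I (prod_curve u v) x, is_o (rep (I a)) &
      fintegral J (prod_curve u v) a b = rep (I b)].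
  move=> su sv.
  have [K GK Ka] := antiderivative cvx wide (fun x => prod_locNF su sv (x := x)) Ja.
  have [sK dK] := local_primitive_antider GK.
  have : exists w, exists I, antider J (prod_curve u v) a I /\ w = rep (I b).
    exists (rep (K b)), K; split => //; split => //; split => //.
    by apply/eqoP; apply: is_o_ext Ka => t _; rewrite subr0.
  move=> /(epsilon_spec (inhabits (fun _ : R => 0 : R)))[I [[sI [/eqoP Ia dI]] E]].
  exists I; split; [exact: (antider_local_primitive cvx wide sI dI)| |exact: E].
  by apply: is_o_ext Ia => t _; rewrite subr0.
have sqE u : (fun (x : FR R) (s : R) => rep (u x) s ^+ 2) = prod_curve u u.
  by apply/funext => x; apply/funext => s; rewrite expr2.
rewrite !sqE.
have [I1 [G1 a1 ->]] := spec f g sf sg.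
have [I2 [G2 a2 ->]] := spec f f sf sf.
have [I3 [G3 a3 ->]] := spec g g sg sg.
have [X [Y [Z [XYZ oX oY oZ]]]] := cs_rel_le cvx wide sf sg G1 G2 G3 Ja Jb ab.
have {a1}oX : is_o (fun t => rep (I1 b) t - X t).
  by apply: is_o_ext (is_oD oX a1) => t _; ring.
have {a2}oY : is_o (fun t => rep (I2 b) t - Y t).
  by apply: is_o_ext (is_oD oY a2) => t _; ring.
have {a3}oZ : is_o (fun t => rep (I3 b) t - Z t).
  by apply: is_o_ext (is_oD oZ a3) => t _; ring.
have bnd (v w : R -> R) : bounded_curve v -> is_o (fun t => v t - w t) -> bounded_curve w.
  move=> bv /is_oN/is_o_bounded/(boundedD bv); apply: bounded_ext => t _; ring.
have b1 := in_Ro_bounded (rep_Ro (I1 b)).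
have b2 := in_Ro_bounded (rep_Ro (I2 b)).
have b3 := in_Ro_bounded (rep_Ro (I3 b)).
have e1 := is_o_mul_congr (bnd _ _ b1 oX) b1 oX oX.
have e2 := is_o_mul_congr (bnd _ _ b2 oY) b3 oY oZ.
have e3 := is_oB e1 e2.
(* The least nonnegative slack that makes the inequality true for every [t]. It is o(t): since
   [X^2 <= Y Z], it is at most the absolute value of the error in [e3]. *)
pose w t := Num.max 0 (rep (I1 b) t ^+ 2 - rep (I2 b) t * rep (I3 b) t).
have ow : is_o w.
  apply: is_o_le e3; apply: near0S XYZ => t [_ _ h]; rewrite /w.
  case: (leP 0 (rep (I1 b) t ^+ 2 - rep (I2 b) t * rep (I3 b) t)) => h'; last by rewrite normr0.
  rewrite ger0_norm//; apply: le_trans (ler_norm _).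
  by rewrite !expr2 in h *; lra.
exists w; split; first exact: in_Ro_is_o0.
split; first by apply/eqoP; apply: is_o_ext ow => t _; rewrite subr0.
exists 1; split => // t _ _; rewrite -lerBlDl /w le_max lexx orbT//.
Qed.
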